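(* There exists a positive real constant $c$ such that, whenever $G=\mathrm{Sym}(n)$ with $n\geq 3$, $n\neq 6$, or $G=\mathrm{Alt}(n)$ with $n\geq 4$, we have $$cn\leq \kappa(G)\leq \gamma(G)\leq \frac{2}{3}n.$$
   Context: $\mathrm{Sym}(n)$ and $\mathrm{Alt}(n)$ denote the symmetric and alternating groups on $\{1,\dots,n\}$. For a finite non-cyclic group $G$, the normal covering number $\gamma(G)$ is the least number $r$ of pairwise non-conjugate proper subgroups $H_1,\dots,H_r$ of $G$ such that $G=\bigcup_{i=1}^r\bigcup_{g\in G}H_i^g$, i.e. the least number of proper subgroups such that each element of $G$ lies in some conjugate of one of them. For a finite group $G$, $\kappa(G)$ is the maximum size of a set $X$ of conjugacy classes of $G$ such that any pair of elements from distinct classes in $X$ generates $G$ (that is, for all distinct $C,D\in X$ and all $g\in C$, $h\in D$, one has $\langle g,h\rangle=G$). *)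

(* Defs.v *)
From HB Require Import structures.
From mathcomp Require Import all_boot all_order all_fingroup all_solvable.

Set Implicit Arguments.
Unset Strict Implicit.
Unset Printing Implicit Defensive.

Local Open Scope group_scope.

Definition normal_covering (gT : finGroupType) (G : {group gT})
    (S : {set {group gT}}) : bool :=
  [&& [forall H in S, H \proper G],
      [forall H in S, [forall K in S,
         (H != K) ==> (gval K \notin gval H :^: G)]]
    & G :==: \bigcup_(H in S) \bigcup_(g in G) (H :^ g)].

(* The initial value of the minimum bounds every #|S|, so this is a genuine   *)
(* minimum as soon as G has a normal covering, i.e., when G is not cyclic:    *)
(* see gammaP below. For cyclic G the value is meaningless.                   *)
Definition gamma (gT : finGroupType) (G : {group gT}) : nat :=
  \big[minn/#|{group gT}|]_(S : {set {group gT}} | normal_covering G S) #|S|.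

Definition pairwise_generating (gT : finGroupType) (G : {group gT})
    (X : {set {set gT}}) : bool :=
  (X \subset classes G) &&
  [forall C in X, [forall D in X, (C != D) ==>
     [forall g in C, [forall h in D, <<[set g; h]>> == G]]]].

Definition kappa (gT : finGroupType) (G : {group gT}) : nat :=
  \max_(X : {set {set gT}} | pairwise_generating G X) #|X|.

Lemma normal_covering_exists (gT : finGroupType) (G : {group gT}) :
  ~~ cyclic G -> exists S, normal_covering G S.
Proof.
move=> ncG; pose P := [set H : {group gT} | H \proper G].
have actP : [acts G, on P | 'JG].
  apply/actsP=> g Gg H; rewrite !inE /=.
  by rewrite -{1}(conjGid Gg) properJ.
have [_ sXP XO Xex] := orbit_transversalP actP.
set X := orbit_transversal _ _ _ in sXP XO Xex.
exists X; apply/and3P; split.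
- by apply/forall_inP=> H /(subsetP sXP); rewrite inE.
- apply/forall_inP=> H XH; apply/forall_inP=> K XK; apply/implyP=> neHK.
  apply: contra neHK => /imsetP[g Gg defK]; rewrite -XO //.
  by apply/imsetP; exists g => //; apply/val_inj.
- rewrite eqEsubset; apply/andP; split; last first.
    apply/bigcupsP=> H /(subsetP sXP); rewrite inE => /proper_sub sHG.
    by apply/bigcupsP=> g Gg; rewrite -(conjGid Gg) conjSg.
  apply/subsetP=> x Gx.
  have Px : <[x]>%G \in P.
    rewrite inE properE cycle_subG Gx; apply: contra ncG => sGx.
    by apply/cyclicP; exists x; apply/eqP; rewrite eqEsubset sGx cycle_subG.
  have [a Ga Xa] := Xex _ Px.
  apply/bigcupP; exists (<[x]> :^ a)%G => //.
  apply/bigcupP; exists a^-1; rewrite ?groupV //= conjsgK.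
  exact: cycle_id.
Qed.

Lemma gammaP (gT : finGroupType) (G : {group gT}) : ~~ cyclic G ->
  (exists2 S, normal_covering G S & #|S| = gamma G) /\
  (forall S, normal_covering G S -> gamma G <= #|S|).
Proof.
move=> /normal_covering_exists[S0 covS0].
have le_gamma S : normal_covering G S -> gamma G <= #|S|.
  move=> covS; rewrite /gamma; have := mem_index_enum S.
  elim: (index_enum _) => // T r IH; rewrite in_cons big_cons.
  case/orP=> [/eqP<- | /IH le_r]; first by rewrite covS geq_minl.
  by case: ifP => // _; rewrite geq_min le_r orbT.
split=> //; suff [eq_g | //] :
    gamma G = #|{group gT}| \/ exists2 S, normal_covering G S & #|S| = gamma G.
  exists S0 => //; apply/eqP; rewrite eqn_leq le_gamma // andbT eq_g.
  exact: max_card.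
rewrite /gamma; elim/big_rec: _ => [|S m covS IH]; first by left.
by rewrite /minn; case: ltnP => _; [right; exists S | ].
Qed.

(* Main.v *)
(* Lower bound. Take elements with cycle lengths k, l (e times) and m, where   *)
(* e is 1 or 2 according to the parity wanted, k, l and m are pairwise         *)
(* coprime, k <= n / 7 and k + e l < n / 2. If two such elements x, y have no  *)
(* common length of a proper invariant set, then <x, y> is transitive; it is   *)
(* primitive, because powers of x are a k-cycle and an m-cycle, which forces a *)
(* proper block to have the size of an x-invariant set, and likewise for y.    *)
(* A primitive group with a proper Jordan set is 2-transitive (Jordan), and a  *)
(* 2-transitive group with an element moving few points contains a 3-cycle     *)
(* (Bochert), so <x, y> contains Alt(n). Suitable pairs (k, l) have positive   *)
(* density, since the density of the failures is at most                       *)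
(* 3 sum_(d odd, d >= 3) d^-2 <= 3/4, and every pair shares an invariant       *)
(* length with O(n) others only; so a maximal subfamily without common         *)
(* invariant lengths is of linear size.                                        *)
(* Upper bound. Set stabilisers cover all elements with a small orbit, and the *)
(* n-cycles are covered by one or two cyclic subgroups.                        *)
Require Import Defs.
From mathcomp Require Import all_boot all_order all_algebra all_fingroup.
From mathcomp Require Import all_solvable reals.
From mathcomp Require Import zify.

Set Implicit Arguments.
Unset Strict Implicit.
Unset Printing Implicit Defensive.

(** * Cycle lengths *)

(** Lower bound. The invariant sets of a permutation with one cycle of length k, e cycles of length
    l and one of length m have size a k + i l + b m with a, b <= 1 and i <= e. When m > n / 2,
    whether two such permutations share an invariant size other than 0 and n is therefore a question
    about the small sums a k + i l. By [card_not_coprime_lengths] a positive proportion of the pairs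
    (k, l) gives pairwise coprime lengths, and [exists_lengths] extracts from them a family of size
    at least n / 10000 in which no nonzero small sum of one pair equals one of another.

    Let x and y come from distinct pairs of the family. Every orbit of <x, y> is invariant under
    both, so the group is transitive. By [marked_block] a block with more than one point has the
    size of an x-invariant set and of a y-invariant set, so the group is primitive.
    [jordan_primitive_trans2] makes it 2-transitive and [trans2_small_supp_Alt] makes it contain
    Alt(n); this is [marked_pair_Alt]. The parity of e decides the sign of x, so that <x, y> is G
    itself.

    Middle inequality ([kappa_le_gamma]). If two classes of a pairwise generating family met
    conjugates of the same component of a normal covering, one conjugate would contain a generating
    pair; so there are at least as many components as classes.

    Upper bound ([gamma_bound]). A permutation that is not an n-cycle preserves a set of size
    between 1 and n / 2, so set stabilisers together with cyclic groups for the n-cycles cover G.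
    For Alt(n) with n odd, stabilisers of sets of size at most n / 3 suffice, which pays for the
    second cyclic group. Sym(4) needs its own covering. *)

Lemma card_congruent (N d : nat) (J : {set 'I_N}) : 0 < d ->
  (forall i j : 'I_N, i \in J -> j \in J -> i <= j -> d %| j - i) ->
  #|J| <= N %/ d + 1.
Proof.
move=> d0 congJ; rewrite addn1.
have le_q (i : 'I_N) : i %/ d < (N %/ d).+1 by rewrite ltnS leq_div2r // ltnW.
rewrite -[X in _ <= X]card_ord -(@card_in_imset _ _ (fun i => Ordinal (le_q i))) ?max_card //.
have inj_le (i j : 'I_N) : i \in J -> j \in J -> i <= j -> i %/ d = j %/ d -> i = j.
  move=> Ji Jj le_ij eq_q; apply: ord_inj; apply/eqP; rewrite eqn_leq le_ij /=.
  have := congJ i j Ji Jj le_ij; rewrite -eqn_mod_dvd // => /eqP eq_r.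
  by rewrite (divn_eq i d) (divn_eq j d) eq_q eq_r.
move=> i j Ji Jj [eq_q]; case/orP: (leq_total i j) => le_ij; first exact: inj_le.
by apply/esym/inj_le.
Qed.

Lemma card_setX_le (T U : finType) (P : {set T * U}) (A : {set T}) (B : {set U}) (b : nat) :
  (forall p, p \in P -> p.1 \in A /\ p.2 \in B) -> #|A| <= b -> #|B| <= b ->
  #|P| <= b ^ 2.
Proof.
move=> sP leA leB; rewrite -mulnn; apply: leq_trans (leq_mul leA leB).
by rewrite -cardsX; apply/subset_leq_card/subsetP=> p /sP[Ap Bp]; rewrite !inE Ap.
Qed.

(* Telescoping: 4 / (2 t + 3)^2 <= 1 / (t + 1) - 1 / (t + 2). *)
Lemma sum_sqr_div_odd (N T : nat) : 4 * \sum_(t < T) (N %/ t.*2.+3) ^ 2 <= N ^ 2.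
Proof.
suff: 4 * T.+1 * \sum_(t < T) (N %/ t.*2.+3) ^ 2 <= N ^ 2 * T.
  by move: (\sum_(t < T) _) => S leS; rewrite -(leq_pmul2r (ltn0Sn T)); nia.
elim: T => [|T IHT]; first by rewrite big_ord0 muln0.
rewrite big_ord_recr /=; move: (\sum_(t < T) _) IHT => S IHS.
have : N %/ T.*2.+3 * T.*2.+3 <= N by apply: leq_divM.
move: (N %/ _) => x le_x; rewrite -(leq_pmul2r (ltn0Sn T)).
have : (x * T.*2.+3) ^ 2 <= N ^ 2 by rewrite leq_sqr.
rewrite -!mulnn -muln2 => le_x2.
have : T.+2 * (4 * T.+1 * S) <= T.+2 * (N * N * T) by rewrite leq_mul2l mulnn IHS orbT.
have : 4 * T.+1 * T.+2 * (x * x) <= N * N.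
  apply: leq_trans le_x2; rewrite [leqRHS]mulnACA mulnC leq_mul2l.
  by apply/orP; right; nia.
by nia.
Qed.

Lemma sum_sqr_divS_odd (N : nat) :
  18 * \sum_(t < N) (N %/ t.*2.+3 + 1) ^ 2 <= 5 * N ^ 2 + 180 * N.
Proof.
(* Termwise 9 (x + 1)^2 <= 10 x^2 + 90, which is (x - 9)^2 >= 0. This absorbs the rounding term at
   the price of a density 5/6 instead of 3/4 in the count of failures. *)
have : 9 * \sum_(t < N) (N %/ t.*2.+3 + 1) ^ 2
       <= \sum_(t < N) (10 * (N %/ t.*2.+3) ^ 2 + 90).
  rewrite big_distrr /=; apply: leq_sum => t _; move: (N %/ _) => x.
  by rewrite -!mulnn; have [? | ?] := leqP x 9; nia.
rewrite big_split /= -big_distrr /= sum_nat_const card_ord.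
have := sum_sqr_div_odd N N.
move: (\sum_(t < N) (_ %/ _) ^ 2) (\sum_(t < N) (_ + 1) ^ 2) => S1 S2.
by rewrite -!mulnn; lia.
Qed.

(** Greedy bound: by maximality, the neighbourhoods of the members of a maximal independent subset
    of [P] cover [P]. *)
Lemma exists_independent (T : finType) (P : {set T}) (r : rel T) (b : nat) :
  reflexive r -> symmetric r ->
  (forall p, #|[set q | r p q]| <= b) ->
  exists I : {set T}, [/\ I \subset P, #|P| <= #|I| * b
    & forall p q, p \in I -> q \in I -> r p q -> p = q].
Proof.
move=> rxx rC le_b.
pose indep (I : {set T}) := (I \subset P) &&
  [forall p in I, forall q in I, r p q ==> (p == q)].
have indep0 : indep set0 by rewrite /indep sub0set; apply/forall_inP=> p; rewrite inE.
have [I maxI _] := maxset_exists indep0.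
have [/andP[sIP /forall_inP indI] Imax] := maxsetP maxI.
have {}indI p q : p \in I -> q \in I -> r p q -> p = q.
  by move=> Ip Iq rpq; have /forall_inP/(_ q Iq)/implyP/(_ rpq)/eqP := indI p Ip.
exists I; split=> //.
suff sPU : P \subset \bigcup_(p in I) [set q | r p q].
  apply: leq_trans (subset_leq_card sPU) _; rewrite -sum_nat_const.
  elim/big_rec2: _ => [|p m U _ le_m]; first by rewrite cards0.
  by apply: leq_trans (leq_card_setU _ _) _; apply: leq_add.
apply/subsetP=> q Pq; have [Iq | nIq] := boolP (q \in I).
  by apply/bigcupP; exists q; rewrite ?inE.
have [/exists_inP[p Ip rpq] | none] := boolP [exists p in I, r p q].
  by apply/bigcupP; exists p; rewrite ?inE.
suff /Imax/(_ (subsetUr _ _)) eqI : indep (q |: I) by rewrite -eqI setU11 in nIq.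
rewrite /indep subUset sub1set Pq sIP /=.
have nr p : p \in I -> r p q = false.
  by move=> Ip; apply: contraNF none => rpq; apply/exists_inP; exists p.
apply/forall_inP=> x Ix; apply/forall_inP=> y Iy; apply/implyP=> rxy.
move: Ix Iy rxy => /setU1P[-> | Ix] /setU1P[-> | Iy] //.
- by rewrite rC nr.
- by rewrite nr.
- by move=> rxy; apply/eqP/indI.
Qed.

(** The hypothesis on [f] says that it is an arithmetic progression of difference u or -u; as d is
    coprime to u, the indices where d divides [f] form one residue class. *)
Lemma odd_dvd_bound (N d : nat) (f : nat -> nat) (u : nat) :
  0 < d -> coprime d u ->
  (forall i j, i <= j < N -> f j = f i + u * (j - i) \/ f i = f j + u * (j - i)) ->
  #|[set i : 'I_N | d %| f i]| <= N %/ d + 1.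
Proof.
move=> d0 co_du f_arith; apply: card_congruent => // i j; rewrite !inE => di dj le_ij.
rewrite -(Gauss_dvdr _ co_du); have [|eqf|eqf] := f_arith i j; first by rewrite le_ij /=.
  by rewrite -(dvdn_addr _ di) -eqf.
by rewrite -(dvdn_addr _ dj) -eqf.
Qed.

(* p = (i, j) encodes the cycle lengths k = 2 i + 3, l (e times) and          *)
(* m = n - k - e l with l = 2 j + 3.                                          *)
Definition len1 (N : nat) (p : 'I_N * 'I_N) : nat := p.1.*2 + 3.
Definition len2 (N : nat) (p : 'I_N * 'I_N) : nat := p.2.*2 + 3.

Definition coprime_lengths (n e N : nat) (p : 'I_N * 'I_N) : bool :=
  [&& coprime (len1 p) (len2 p), coprime (len1 p) (n - len1 p - e * len2 p)
    & coprime (len2 p) (n - len1 p - e * len2 p)].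

(** A common divisor of two of the three lengths is odd, since k and l are odd. If an odd d divides
    two of them, then i and j each lie in one residue class modulo d, as k and m together determine
    e l modulo d, and l and m determine k. So each of the three kinds of failure costs (N / d + 1)^2
    pairs. *)
Lemma card_not_coprime_lengths (n e N : nat) : 0 < e <= 2 -> 20 * N <= n -> 360 <= N ->
  6 * #|[set p | ~~ @coprime_lengths n e N p]| <= 5 * N ^ 2 + 180 * N.
Proof.
move=> e12 le_Nn N_big.
have e_cases : e = 1 \/ e = 2 by lia.
have len_le (p : 'I_N * 'I_N) : len1 p <= 2 * N + 1 /\ len2 p <= 2 * N + 1.
  by have := ltn_ord p.1; have := ltn_ord p.2; rewrite /len1 /len2; lia.
pose d (t : nat) := t.*2.+3.
pose bad1 t := [set p : 'I_N * 'I_N | (d t %| len1 p) && (d t %| len2 p)].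
pose bad2 t := [set p : 'I_N * 'I_N | (d t %| len1 p) && (d t %| n - len1 p - e * len2 p)].
pose bad3 t := [set p : 'I_N * 'I_N | (d t %| len2 p) && (d t %| n - len1 p - e * len2 p)].
have co2 t : coprime (d t) 2 by rewrite coprimen2 /d /= odd_double.
have coe t : coprime (d t) e by case: e_cases => ->; rewrite ?coprimen1 ?co2.
pose A t := [set i : 'I_N | d t %| i.*2 + 3].
have leA t : #|A t| <= N %/ d t + 1.
  apply: (@odd_dvd_bound N (d t) (fun i => i.*2 + 3) 2) => // i j; lia.
have leB1 t : #|bad1 t| <= (N %/ d t + 1) ^ 2.
  by apply: card_setX_le (leA t) (leA t) => p; rewrite !inE => /andP.
have leB2 t : #|bad2 t| <= (N %/ d t + 1) ^ 2.
  apply: (@card_setX_le _ _ _ (A t) [set j : 'I_N | d t %| n - e * (j.*2 + 3)]) => //.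
    move=> p; rewrite !inE => /andP[d1 d2]; split=> //.
    rewrite -(dvdn_addr _ d2) in d1.
    move: d1; rewrite subnAC subnK // /len1 /len2.
    have := len_le p; rewrite /len1 /len2; by case: e_cases => ->; lia.
  apply: (@odd_dvd_bound N (d t) (fun j => n - e * (j.*2 + 3)) (e * 2)) => //.
    by rewrite coprimeMr coe co2.
  move=> i j /andP[le_ij lt_jN]; by case: e_cases => ->; lia.
have leB3 t : #|bad3 t| <= (N %/ d t + 1) ^ 2.
  apply: (@card_setX_le _ _ _ [set i : 'I_N | d t %| n - (i.*2 + 3)] (A t)) => //.
    move=> p; rewrite !inE => /andP[d1 d2]; split=> //.
    have {}d1 : d t %| e * len2 p by rewrite dvdn_mull.
    rewrite -(dvdn_addr _ d2) in d1.
    move: d1; rewrite subnK // /len1 /len2.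
    have := len_le p; rewrite /len1 /len2; by case: e_cases => ->; lia.
  apply: (@odd_dvd_bound N (d t) (fun j => n - (j.*2 + 3)) 2) => //.
  by move=> i j /andP[le_ij lt_jN]; lia.
have bad_gcd a b : odd a -> a <= 2 * N + 1 -> ~~ coprime a b ->
    exists2 t : 'I_N, d t %| a & d t %| b.
  move=> odd_a le_a nco; have a0 : 0 < a by case: a odd_a {le_a nco}.
  have g_odd : odd (gcdn a b) by apply: dvdn_odd odd_a; apply: dvdn_gcdl.
  have g_le : gcdn a b <= 2 * N + 1 by apply: leq_trans le_a; apply/dvdn_leq/dvdn_gcdl.
  have g_eq : gcdn a b = d (gcdn a b - 3)./2.
    by move: g_odd nco; rewrite /d /coprime; move: (gcdn a b) => g; lia.
  have g_lt : (gcdn a b - 3)./2 < N by lia.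
  by exists (Ordinal g_lt); rewrite /= -g_eq ?dvdn_gcdl ?dvdn_gcdr.
have odd1 (p : 'I_N * 'I_N) : odd (len1 p) by rewrite oddD odd_double.
have odd2 (p : 'I_N * 'I_N) : odd (len2 p) by rewrite oddD odd_double.
have cover : [set p | ~~ coprime_lengths n e p]
     \subset \bigcup_(t < N) (bad1 t :|: bad2 t :|: bad3 t).
  apply/subsetP=> p; rewrite inE !negb_and.
  have [le1 le2] := len_le p.
  by case/or3P=> /bad_gcd[] // t d1 d2; apply/bigcupP; exists t; rewrite ?inE ?d1 ?d2 ?orbT.
have := subset_leq_card cover.
have : #|\bigcup_(t < N) (bad1 t :|: bad2 t :|: bad3 t)|
    <= \sum_(t < N) 3 * (N %/ d t + 1) ^ 2.
  elim/big_rec2: _ => [|t m U _ le_m]; first by rewrite cards0.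
  apply: leq_trans (leq_card_setU _ _) _; apply: leq_add => //.
  rewrite -[3]/(1 + 1 + 1) !mulnDl mul1n.
  apply: leq_trans (leq_card_setU _ _) _; apply: leq_add => //.
  by apply: leq_trans (leq_card_setU _ _) _; apply: leq_add.
rewrite -big_distrr /=; have := sum_sqr_divS_odd N; rewrite -/d.
move: (\sum_(t < N) _) => S.
move: #|\bigcup_(t < N) _| #|[set p | _]| (N ^ 2) => u v N2; clear; lia.
Qed.

Lemma exists_lengths (n e : nat) : 0 < e <= 2 -> 20 * 361 <= n ->
  exists N, exists I : {set 'I_N * 'I_N},
    [/\ 1 < N /\ 20 * N <= n, n <= 100 * 100 * #|I|, forall p, p \in I -> coprime_lengths n e p
      & forall p q (a b : bool) (i j : nat), p \in I -> q \in I -> i <= 2 -> j <= 2 ->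
        a + i > 0 -> b + j > 0 ->
        a * len1 p + i * len2 p = b * len1 q + j * len2 q -> p = q].
Proof.
move=> e12 n_big.
have [N [le_Nn lt_nN]] : exists N, 20 * N <= n /\ n < 20 * N + 20.
  by exists (n %/ 20); lia.
have N_big : 360 <= N by lia.
pose P := [set p | @coprime_lengths n e N p].
pose frm (x : bool * 'I_3) (p : 'I_N * 'I_N) := x.1 * len1 p + x.2 * len2 p.
pose nz (x : bool * 'I_3) := x.1 + x.2 > 0.
(* Conflict relation: some nonzero small sum of [p] equals one of [q]. There are 6 * 6 choices of
   coefficients, and a nonzero sum of prescribed value leaves at most N pairs [q], hence the degree
   bound 36 N. *)
pose r (p q : 'I_N * 'I_N) := [exists x, exists y, [&& nz x, nz y & frm x p == frm y q]].
have rxx : reflexive r.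
  by move=> p; apply/existsP; exists (true, ord0); apply/existsP; exists (true, ord0); rewrite /nz /=.
have rC : symmetric r.
  suff rC p q : r p q -> r q p by move=> p q; apply/idP/idP; apply: rC.
  case/existsP=> x /existsP[y /and3P[nx ny /eqP eq_f]].
  by apply/existsP; exists y; apply/existsP; exists x; rewrite nx ny eq_f /=.
have le_fiber (y : bool * 'I_3) s : nz y -> #|[set q | frm y q == s]| <= N.
  case: y => b j; rewrite /nz /frm /= => nzy.
  rewrite -[leqRHS]card_ord; have [j0 | j0] := posnP j.
    rewrite -(@card_in_imset _ _ snd) ?max_card // => -[i1 i2] [i3 i4].
    rewrite !inE /= /len1 /len2 /= j0 => /eqP e1 /eqP e2 /= e3; congr pair => //.
    by apply: ord_inj; move: e1 e2 nzy; rewrite j0; case: b => //=; lia.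
  rewrite -(@card_in_imset _ _ fst) ?max_card // => -[i1 i2] [i3 i4].
  rewrite !inE /= /len1 /len2 /= => /eqP e1 /eqP e2 /= e3; congr pair => //.
  apply: ord_inj; move: e1; rewrite -e2 e3 => /addnI/eqP.
  by rewrite eqn_pmul2l // => /eqP; lia.
have le_deg p : #|[set q | r p q]| <= 36 * N.
  have cover : [set q | r p q] \subset
      \bigcup_(x : bool * 'I_3) \bigcup_(y | nz y) [set q | frm y q == frm x p].
    apply/subsetP=> q; rewrite inE => /existsP[x /existsP[y /and3P[nx ny /eqP eq_f]]].
    by apply/bigcupP; exists x => //; apply/bigcupP; exists y => //; rewrite inE eq_f.
  apply: leq_trans (subset_leq_card cover) _.
  have leU (x : bool * 'I_3) :
      #|\bigcup_(y | nz y) [set q | frm y q == frm x p]| <= 6 * N.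
    have -> : 6 * N = #|{: bool * 'I_3}| * N by rewrite card_prod card_bool card_ord.
    rewrite -sum_nat_const.
    rewrite big_mkcond; elim/big_rec2: _ => [|y m U _ le_m]; first by rewrite cards0.
    apply: leq_trans (leq_card_setU _ _) _; apply: leq_add => //.
    by case: ifP => [/le_fiber// | _]; rewrite cards0.
  have -> : 36 * N = #|{: bool * 'I_3}| * (6 * N) by rewrite card_prod card_bool card_ord; lia.
  rewrite -sum_nat_const; elim/big_rec2: _ => [|x m U _ le_m]; first by rewrite cards0.
  by apply: leq_trans (leq_card_setU _ _) _; apply: leq_add.
have [I [sIP leP indI]] := @exists_independent _ P r (36 * N) rxx rC le_deg.
exists N, I; split.
- by split; first exact: leq_trans N_big.
- have := cardsC P; rewrite card_prod !card_ord.
  have -> : ~: P = [set p | ~~ coprime_lengths n e p] by apply/setP=> p; rewrite !inE.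
  have := card_not_coprime_lengths e12 le_Nn N_big.
  move: leP; move: #|P| #|I| #|[set _ | _]| => s t u; rewrite -mulnn => leP le_u def_u.
  (* For N >= 360 the term 180 N is at most N^2 / 2, so at least N^2 / 12 pairs are good and N <= 12
     * 36 * #|I| = 432 * #|I|. *)
  have le_s : N * N <= 12 * s by nia.
  have : N * N <= (432 * t) * N by lia.
  by rewrite leq_pmul2r; lia.
- by move=> p /(subsetP sIP); rewrite inE.
- move=> p q a b i j Ip Iq i2 j2 ai bj eq_f; apply: indI => //.
  apply/existsP; exists (a, inord i); apply/existsP; exists (b, inord j).
  by rewrite /nz /frm /= !inordK // ai bj eq_f /=.
Qed.

Local Open Scope group_scope.

(** * Recognising the alternating group *)

Definition cycle3 (T : finType) (a b c : T) : {perm T} := tperm a b * tperm a c.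

Lemma cycle3J (T : finType) (a b c : T) (s : {perm T}) :
  cycle3 a b c ^ s = cycle3 (s a) (s b) (s c).
Proof. by rewrite conjMg !tpermJ. Qed.

Lemma cycle3V (T : finType) (a b c : T) : (cycle3 a b c)^-1 = cycle3 a c b.
Proof. by rewrite invMg !tpermV. Qed.

Lemma cycle3E (T : finType) (a b c : T) : uniq [:: a; b; c] ->
  [/\ cycle3 a b c a = b, cycle3 a b c b = c, cycle3 a b c c = a
    & forall z, z \notin [:: a; b; c] -> cycle3 a b c z = z].
Proof.
rewrite /= !inE negb_or => /and3P[/andP[ab ac] bc _].
split=> [|||z]; rewrite /cycle3 !permM ?tpermL ?tpermR //.
- by rewrite tpermD // eq_sym.
- by rewrite tpermL.
- by rewrite (tpermD ac bc) tpermR.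
rewrite !inE !negb_or => /and3P[za zb zc].
by rewrite !tpermD // eq_sym.
Qed.

Lemma cycle3_rot (T : finType) (a b c : T) : uniq [:: a; b; c] ->
  cycle3 a b c = cycle3 b c a.
Proof.
move=> Uabc; have [Ea Eb Ec Ez] := cycle3E Uabc.
have Ubca : uniq [:: b; c; a] by rewrite -(rot_uniq 1) in Uabc.
have [Fb Fc Fa Fz] := cycle3E Ubca.
apply/permP=> z; have [|zN] := boolP (z \in [:: a; b; c]).
  by rewrite !inE => /or3P[] /eqP->; rewrite ?Ea ?Eb ?Ec ?Fa ?Fb ?Fc.
by rewrite (Ez z zN) (Fz z) // -(mem_rot 2).
Qed.

Lemma mem_tperm_pairs (T : finType) (G : {group {perm T}}) :
  (forall a b c : T, uniq [:: a; b; c] -> cycle3 a b c \in G) ->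
  forall a b c d : T, a != b -> c != d -> tperm a b * tperm c d \in G.
Proof.
move=> G3.
have share a b d : a != b -> a != d -> tperm a b * tperm a d \in G.
  move=> ab ad; have [<-|bd] := eqVneq b d; first by rewrite tperm2 group1.
  by apply: G3; rewrite /= !inE negb_or ab ad bd.
move=> a b c d ab cd; have [ac|ac] := eqVneq a c.
  by rewrite -ac share // ac.
have -> : tperm a b * tperm c d
          = (tperm a b * tperm a c) * (tperm a c * tperm c d).
  by rewrite mulgA -(mulgA (tperm a b)) tperm2 mulg1.
by rewrite groupM ?share // tpermC share // eq_sym.
Qed.

Lemma Alt_sub_cycle3 (T : finType) (G : {group {perm T}}) :
  (forall a b c : T, uniq [:: a; b; c] -> cycle3 a b c \in G) -> 'Alt_T \subset G.
Proof.
move=> G3; apply/subsetP=> s; rewrite Alt_even.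
have [ts -> dts] := prod_tpermP s; rewrite odd_perm_prod //.
have [n] := ubnP (size ts); elim: n ts dts => // n IHn [|t1 [|t2 ts]] //=.
  by rewrite big_nil group1.
case/and3P=> d1 d2 dts ltn ev; rewrite !big_cons mulgA groupM //.
  exact: mem_tperm_pairs.
by apply: IHn => //; [by move: ltn; rewrite ltnS => /ltnW | move: ev; rewrite negbK].
Qed.

Definition trans2 (T : finType) (G : {set {perm T}}) :=
  forall a b c d : T, a != b -> c != d -> exists2 g, g \in G & g a = c /\ g b = d.

(** Take a maximal set S of at least three points all of whose 3-cycles lie in G. If z is outside S,
    one 3-cycle through z and two points of S spreads, by conjugation inside S, to all of them,
    against maximality. *)
Lemma trans2_cycle3_Alt (T : finType) (G : {group {perm T}}) (a b c : T) :
  trans2 G -> uniq [:: a; b; c] -> cycle3 a b c \in G -> 'Alt_T \subset G.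
Proof.
move=> G2 Uabc Gabc.
pose full (S : {set T}) := [forall x in S, [forall y in S, [forall z in S,
  uniq [:: x; y; z] ==> (cycle3 x y z \in G)]]].
have fullP (S : {set T}) : reflect (forall x y z, x \in S -> y \in S -> z \in S ->
    uniq [:: x; y; z] -> cycle3 x y z \in G) (full S).
  apply: (iffP forall_inP) => [H x y z Sx Sy Sz | H x Sx].
    exact/implyP/(forall_inP (forall_inP (H x Sx) y Sy) z Sz).
  apply/forall_inP=> y Sy; apply/forall_inP=> z Sz; apply/implyP; exact: H.
pose P (S : {set T}) := (2 < #|S|) && full S.
have P0 : P [set a; b; c].
  apply/andP; split.
    have -> : [set a; b; c] = [set x in [:: a; b; c]].
      by apply/setP=> x; rewrite !inE orbA.
    by rewrite cardsE (card_uniqP Uabc).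
  apply/fullP=> x y z; rewrite !inE -!orbA => Sx Sy Sz.
  have Gacb : cycle3 a c b \in G by rewrite -cycle3V groupV.
  have Uacb : uniq [:: a; c; b].
    move: Uabc; rewrite /= !inE !negb_or => /and3P[/andP[-> ->] bc _].
    by rewrite eq_sym bc.
  have Ubca : uniq [:: b; c; a] by rewrite -(rot_uniq 1) in Uabc.
  have Ucba : uniq [:: c; b; a] by rewrite -(rot_uniq 1) in Uacb.
  have G1 : cycle3 b c a \in G by rewrite -cycle3_rot.
  have G3 : cycle3 c a b \in G by rewrite -cycle3_rot.
  have G4 : cycle3 c b a \in G by rewrite -cycle3_rot.
  have G5 : cycle3 b a c \in G by rewrite -cycle3_rot.
  case/or3P: Sx => /eqP->; case/or3P: Sy => /eqP->; case/or3P: Sz => /eqP-> //;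
    by rewrite /= !inE eqxx ?orbT ?andbF.
have [S maxS sP0S] := @maxset_exists T P _ P0.
have [/andP[S3 /fullP fS] Smax] := maxsetP maxS.
have [allS | ] := boolP [forall x, x \in S].
  apply: Alt_sub_cycle3 => x y z; apply: fS; exact: (forallP allS).
rewrite negb_forall => /existsP[z Sz].
suff: P (z |: S).
  by move/Smax/(_ (subsetUr _ _)) => defS; rewrite -defS setU11 in Sz.
rewrite /P cardsU1 Sz (leq_trans S3) ?leqnSn ?leq_addl //=.
have zN x : x \in S -> z != x by apply: contraTneq => <-.
pose H x y := cycle3 x y z \in G.
have u3 x y : x \in S -> y \in S -> x != y -> uniq [:: x; y; z].
  by move=> Sx Sy xy; rewrite /= !inE negb_or xy !(eq_sym _ z) !zN.
have Hsym x y : x \in S -> y \in S -> x != y -> H x y -> H y x.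
  move=> Sx Sy xy Hxy; rewrite /H -groupV cycle3V.
  by rewrite -cycle3_rot // u3.
have Hstep x y w : x \in S -> y \in S -> w \in S -> uniq [:: x; y; w] ->
    H x y -> H x w.
  move=> Sx Sy Sw Uxyw Hxy.
  have Uxwy : uniq [:: x; w; y].
    move: Uxyw; rewrite /= !inE !negb_or => /and3P[/andP[-> ->] yw _].
    by rewrite eq_sym yw.
  have xw : x != w by move: Uxwy; rewrite /= !inE negb_or => /and3P[/andP[]].
  have /groupJ/(_ Hxy) := fS _ _ _ Sx Sw Sy Uxwy.
  have := groupJ Hxy (fS _ _ _ Sx Sw Sy Uxwy).
  have [Ex Ew Ey Ez] := cycle3E Uxwy.
  rewrite cycle3J Ex Ey Ez ?inE ?negb_or ?zN // => Hwx _.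
  by apply: Hsym; rewrite // eq_sym.
have [x [y [Sx Sy xy Hxy]]] :
    exists x, exists y, [/\ x \in S, y \in S, x != y & H x y].
  have /card_gt0P[x Sx] : 0 < #|S| by apply: leq_trans S3.
  have xz : x != z by rewrite eq_sym zN.
  have ab : a != b by move: Uabc; rewrite /= !inE negb_or => /and3P[/andP[]].
  (* This gives a 3-cycle (x z w) in G. If w is in S it is already of the wanted form; otherwise it
     conjugates a 3-cycle (x y y') of S into (z y y'). *)
  have [g Gg [ga gb]] := G2 a b x z ab xz.
  pose w := g c.
  have Uxzw : uniq [:: x; z; w].
    by rewrite -ga -gb -[[:: _; _; _]]/(map g [:: a; b; c]) map_inj_uniq //; apply: perm_inj.
  have Gxzw : cycle3 x z w \in G by rewrite -ga -gb -cycle3J groupJ.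
  have [xw zw] : x != w /\ z != w.
    by move: Uxzw; rewrite /= !inE negb_or => /and3P[/andP[]].
  have [Sw | Sw] := boolP (w \in S).
    exists w, x; split=> //; first by rewrite eq_sym.
    by rewrite /H cycle3_rot //; apply: u3 => //; rewrite eq_sym.
  have [y [Sy xy]] : exists y, y \in S /\ x != y.
    have /card_gt0P[y] : 0 < #|S :\ x| by move: S3; rewrite (cardsD1 x) Sx; case: #|_|.
    by rewrite !inE eq_sym => /andP[xy Sy]; exists y.
  have [y' [Sy' xy' yy']] : exists y', [/\ y' \in S, x != y' & y != y'].
    have /card_gt0P[y'] : 0 < #|S :\ x :\ y|.
      move: S3; rewrite (cardsD1 x) Sx (cardsD1 y) !inE Sy eq_sym xy.
      by case: #|_|.
    by rewrite !inE !(eq_sym y') => /and3P[? ? ?]; exists y'.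
  exists y, y'; split=> //.
  have Uxyy : uniq [:: x; y; y'] by rewrite /= !inE negb_or xy xy' yy'.
  have := groupJ (fS _ _ _ Sx Sy Sy' Uxyy) Gxzw.
  have [Ex _ _ E] := cycle3E Uxzw.
  have notw u : u \in S -> u != w by apply: contraTneq => ->.
  rewrite cycle3J Ex !E ?inE ?negb_or ?(eq_sym _ x) ?(eq_sym _ z)
    ?xy ?xy' ?zN ?notw // => Gzyy.
  rewrite /H -cycle3_rot //.
  by have := u3 _ _ Sy Sy' yy'; rewrite -(rot_uniq 2).
have Hall1 w : w \in S -> w != x -> H x w.
  move=> Sw wx; have [<- // | yw] := eqVneq y w.
  by apply: Hstep Hxy => //; rewrite /= !inE negb_or xy yw eq_sym wx.
have Hall u w : u \in S -> w \in S -> u != w -> H u w.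
  move=> Su Sw uw; have [Eux | ux] := eqVneq u x.
    by rewrite Eux Hall1 // -Eux eq_sym.
  have Hux : H u x by apply: Hsym; rewrite // ?Hall1 // eq_sym.
  have [-> // | wx] := eqVneq w x.
  by apply: Hstep Hux => //; rewrite /= !inE negb_or ux uw eq_sym wx.
apply/fullP=> u v w; rewrite !inE.
case/predU1P=> [-> | Su]; case/predU1P=> [-> | Sv]; case/predU1P=> [-> | Sw] U3;
  try by move: U3; rewrite /= !inE ?eqxx ?orbT ?andbF.
- have vw : v != w by move: U3; rewrite /= !inE => /and3P[].
  by rewrite cycle3_rot //; apply: Hall.
- have uw : u != w by move: U3; rewrite /= !inE negb_or => /and3P[/andP[]].
  by rewrite -cycle3_rot; [apply: Hall | apply: u3]; rewrite // eq_sym.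
- by apply: Hall => //; move: U3; rewrite /= !inE negb_or => /and3P[/andP[]].
- exact: fS.
Qed.

Definition supp (T : finType) (x : {perm T}) : {set T} := [set z | x z != z].

Lemma supp_perm (T : finType) (x : {perm T}) (z : T) :
  (x z \in supp x) = (z \in supp x).
Proof. by rewrite !inE (inj_eq perm_inj). Qed.

Lemma suppJV (T : finType) (x g : {perm T}) (z : T) :
  (z \in supp (x ^ g^-1)) = (g z \in supp x).
Proof.
rewrite !inE -{1}(permK g z) permJ.
by rewrite -(inj_eq (@perm_inj _ g)) permKV.
Qed.

(** The 3-cycle is the commutator of x and y, on the common point p and its images x p and y p. *)
Lemma supp_meet1_cycle3 (T : finType) (G : {group {perm T}}) (x y : {perm T}) (p : T) :
  x \in G -> y \in G -> supp x :&: supp y = [set p] ->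
  exists a, exists b, exists c, uniq [:: a; b; c] /\ cycle3 a b c \in G.
Proof.
move=> Gx Gy defI; pose q := x p; pose r := y p.
have inI z : z \in supp x -> z \in supp y -> z = p.
  by move=> xz yz; apply/set1P; rewrite -defI inE xz.
have /setIP[px py] : p \in supp x :&: supp y by rewrite defI set11.
have qx : q \in supp x by rewrite supp_perm.
have ry : r \in supp y by rewrite supp_perm.
have qp : q != p by rewrite !inE in px.
have rp : r != p by rewrite !inE in py.
have qy : q \notin supp y by apply: contra qp => /(inI _ qx)->.
have rx : r \notin supp x by apply: contra rp => /inI/(_ ry)->.
have qr : q != r by apply: contraNneq qy => ->.
have U3 : uniq [:: q; r; p] by rewrite /= !inE negb_or qr qp rp.
exists q, r, p; split=> //; have [Eq Er Ep Ez] := cycle3E U3.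
have fixx z : z \notin supp x -> x z = z by rewrite inE negbK => /eqP.
have fixy z : z \notin supp y -> y z = z by rewrite inE negbK => /eqP.
suff defc : x * y * cycle3 q r p = y * x.
  by rewrite -(groupMl _ (groupM Gx Gy)) defc groupM.
apply/permP=> z; rewrite (permM (x * y)) (permM x) (permM y).
have [xz | xz] := boolP (z \in supp x); have [yz | yz] := boolP (z \in supp y).
- by rewrite (inI z xz yz) -/q -/r (fixy q qy) (fixx r rx) Eq.
- rewrite (fixy z yz); have [xzp | xzp] := eqVneq (x z) p; first by rewrite xzp -/r Er.
  have yxz : x z \notin supp y by apply: contra xzp => /inI->//; rewrite supp_perm.
  rewrite (fixy _ yxz) Ez // !inE !negb_or xzp (inj_eq perm_inj).
  rewrite andbT; apply/andP; split; first by apply: contraNneq yz => ->.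
  by apply: contraNneq rx => <-; rewrite supp_perm.
- rewrite (fixx z xz); have [yzp | yzp] := eqVneq (y z) p; first by rewrite yzp -/q Ep.
  have xyz : y z \notin supp x by apply: contra yzp => /inI->//; rewrite supp_perm.
  rewrite (fixx _ xyz) Ez // !inE !negb_or yzp (inj_eq perm_inj).
  rewrite andbT; apply/andP; split; last by apply: contraNneq xz => ->.
  by apply: contraNneq qy => <-; rewrite supp_perm.
- rewrite (fixx z xz) (fixy z yz) (fixx z xz) Ez // !inE !negb_or.
  apply/and3P; split; first by apply: contraNneq xz => ->.
    by apply: contraNneq yz => ->.
  by apply: contraNneq xz => ->.
Qed.

(** With I the intersection of the supports, the commutator moves only points of I, y(I) and (x
    y)(I). *)
Lemma card_supp_comm (T : finType) (x y : {perm T}) :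
  #|supp ((x * y)^-1 * (y * x))| <= (3 * #|supp x :&: supp y|)%N.
Proof.
set I := supp x :&: supp y.
have fixx z : z \notin supp x -> x z = z by rewrite inE negbK => /eqP.
have fixy z : z \notin supp y -> y z = z by rewrite inE negbK => /eqP.
apply: (@leq_trans #|I :|: (y @: I :|: (x * y) @: I)|); last first.
  rewrite (leq_trans (leq_card_setU _ _)) // -[3]/(1 + 2)%N mulnDl mul1n leq_add2l.
  rewrite (leq_trans (leq_card_setU _ _)) // !(card_imset _ (@perm_inj _ _)).
  by rewrite mul2n addnn.
apply/subset_leq_card/subsetP=> u.
have [z ->] : exists z, u = (x * y) z by exists ((x * y)^-1 u); rewrite permKV.
rewrite [_ \in supp _]inE -permM mulKVg !permM => neq.
have [xz | xz] := boolP (z \in supp x); have [yz | yz] := boolP (z \in supp y).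
- rewrite !in_setU; apply/or3P/Or33; rewrite -permM; apply: imset_f.
  by rewrite inE xz.
- have : x z \in I.
    rewrite inE supp_perm xz; apply: contraR neq => yxz.
    by rewrite (fixy z yz) (fixy _ yxz).
  by move=> Ixz; rewrite !in_setU (imset_f y Ixz) orbT.
- have : y z \in I.
    rewrite inE supp_perm yz andbT; apply: contraR neq => xyz.
    by rewrite (fixx z xz) (fixx _ xyz).
  by rewrite (fixx z xz) !in_setU => ->.
- by rewrite !(fixx z xz, fixy z yz) eqxx in neq.
Qed.

(** * Averaging over a 2-transitive group *)

Definition offdiag (T : finType) (A : {set T}) : {set T * T} :=
  [set p | [&& p.1 \in A, p.2 \in A & p.1 != p.2]].

Lemma card_offdiag (T : finType) (A : {set T}) : #|offdiag A| = (#|A| * #|A|.-1)%N.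
Proof.
have -> : offdiag A = setX A A :\: [set (a, a) | a in A].
  apply/setP=> -[a b]; rewrite !inE /=.
  case: imsetP => [[c Ac [-> ->]] | not_diag]; first by rewrite eqxx !andbF.
  have [Aa /= | //] := boolP (a \in A); have [Ab /= | //] := boolP (b \in A).
  by apply/eqP=> ab; case: not_diag; exists a; rewrite -?ab.
rewrite cardsD (setIidPr _); last first.
  by apply/subsetP=> _ /imsetP[a Aa ->]; rewrite inE /= Aa.
by rewrite cardsX card_imset ?(mulnC _ _.-1); [case: #|A| => // k; nia | move=> a b []].
Qed.

(* Here w is the number of g in G taking one given ordered pair to another.   *)
Lemma trans2_count (T : finType) (G : {group {perm T}}) : trans2 G ->
  1 < #|T| ->
  exists2 w, 0 < w & forall P Q : {set T * T},
    P \subset offdiag setT -> Q \subset offdiag setT ->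
    \sum_(g in G) #|[set p in P | (g p.1, g p.2) \in Q]| = (#|P| * #|Q| * w)%N.
Proof.
move=> G2 /card_gt1P[a0 [b0 [_ _ ab0]]].
pose cnt (p q : T * T) := #|[set g in G | (g p.1, g p.2) == q]|.
have cnt_le p q p' q' : p \in offdiag setT -> q \in offdiag setT ->
    p' \in offdiag setT -> q' \in offdiag setT -> cnt p q <= cnt p' q'.
  rewrite !inE /= => np nq np' nq'.
  have [h Gh [h1 h2]] := G2 _ _ _ _ np' np; have [k Gk [k1 k2]] := G2 _ _ _ _ nq nq'.
  have inj_hk : injective (fun g => h * g * k) 
    by move=> g g' /= eq_g; apply: (mulgI h); apply: (mulIg k).
  rewrite /cnt -(card_imset _ inj_hk); apply/subset_leq_card/subsetP=> _ /imsetP[g Gg ->].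
  move: Gg; rewrite !inE => /andP[Gg /eqP dq]; rewrite !groupM //= !permM h1 h2.
  by rewrite -dq /= in k1 k2; rewrite k1 k2 -surjective_pairing.
have n0 : (a0, b0) \in offdiag setT by rewrite !inE.
have w_gt0 : 0 < cnt (a0, b0) (a0, b0).
  by apply/card_gt0P; exists 1; rewrite inE group1 !perm1 /=.
exists (cnt (a0, b0) (a0, b0)) => // P Q /subsetP sP /subsetP sQ.
have -> : \sum_(g in G) #|[set p in P | (g p.1, g p.2) \in Q]|
   = \sum_(g in G) \sum_(p in P) \sum_(q in Q) ((g p.1, g p.2) == q).
  apply: eq_bigr => g Gg; rewrite -sum1_card.
  rewrite (eq_bigl (fun p => (p \in P) && ((g p.1, g p.2) \in Q))); last first.
    by move=> p; rewrite inE.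
  rewrite big_mkcondr; apply: eq_bigr => p Pp; case: ifP => Qg.
    rewrite (bigD1 _ Qg) /= eqxx big1 ?addn0 // => q /andP[_].
    by rewrite eq_sym => /negPf->.
  by rewrite big1 // => q Qq; apply/eqP; rewrite eqb0; apply: contraFneq Qg => ->.
rewrite exchange_big /=.
rewrite (eq_bigr (fun _ => #|Q| * cnt (a0, b0) (a0, b0))%N).
  by rewrite sum_nat_const mulnA.
move=> p Pp; rewrite exchange_big /= -sum_nat_const; apply: eq_bigr => q Qq.
have -> : \sum_(g in G) ((g p.1, g p.2) == q) = cnt p q.
  rewrite /cnt -sum1_card [LHS]big_mkcond [RHS]big_mkcond /=.
  by apply: eq_bigr => g _; rewrite inE; case: (g \in G) => //=; case: eqP.
by apply/eqP; rewrite eqn_leq !cnt_le //; [apply: sP | apply: sQ | apply: sP | apply: sQ].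
Qed.

(* Bochert's argument: if every conjugate of an element x of least support    *)
(* met supp x in no or at least 2 points, then averaging over G would force   *)
(* |supp x| to be large, because a conjugate that does not commute with x     *)
(* meets supp x in at least a third of its points.                            *)
Lemma trans2_small_supp_Alt (T : finType) (G : {group {perm T}}) (x0 : {perm T}) :
  trans2 G -> x0 \in G -> x0 != 1 -> (7 * #|supp x0| <= #|T|)%N -> 'Alt_T \subset G.
Proof.
move=> G2 Gx0 nx0 le_x0.
have Px0 : (x0 \in G) && (x0 != 1) by rewrite Gx0.
case: (@arg_minnP _ x0 [pred x | (x \in G) && (x != 1)] (fun x => #|supp x|) Px0)
  => x /andP[Gx nx] minx.
set A := supp x in minx; have {x0 le_x0 nx0 Gx0 Px0} le_A : (7 * #|A| <= #|T|)%N.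
  by apply: leq_trans le_x0; rewrite leq_mul2l minx ?orbT.
have A0 : 0 < #|A|.
  rewrite card_gt0; apply: contraNneq nx => A0; apply/eqP/permP=> z; rewrite perm1.
  by apply/eqP; have := in_set0 z; rewrite -A0 inE => /negbT; rewrite negbK.
pose I (g : {perm T}) := [set a in A | g a \in A].
pose D (g : {perm T}) := [set a in A | (g a \notin A) && (g (x a) \in A)].
have defI g : I g = supp x :&: supp (x ^ g^-1).
  by apply/setP=> a; rewrite [in RHS]inE suppJV inE.
have [/exists_inP[g Gg /cards1P[p Ig]] | no1] := boolP [exists g in G, #|I g| == 1%N].
  rewrite defI in Ig.
  have [a [b [c [U3 Gabc]]]] := supp_meet1_cycle3 Gx (groupJ Gx (groupVr Gg)) Ig.
  exact: trans2_cycle3_Alt Gabc.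
(* At a point a of [D g] the conjugate of x by the inverse of g fixes a but moves x a, so it does
   not commute with x. The commutator is then a nontrivial element of G, whence #|A| <= 3 * #|I g|
   by minimality. Also x maps [D g] into [I g], and #|I g| >= 2 gives #|I g| <= 2 (#|I g| - 1). *)
have key g : g \in G -> (#|A| * #|D g| <= 6 * (#|I g| * #|I g|.-1))%N.
  move=> Gg; have [-> | [a Da]] := set_0Vmem (D g); first by rewrite cards0 muln0.
  have leDI : #|D g| <= #|I g|.
    rewrite -(card_imset _ (@perm_inj _ x)); apply/subset_leq_card/subsetP.
    move=> _ /imsetP[b Db ->]; move: Db; rewrite in_set => /and3P[Ab _ xAb].
    by rewrite in_set xAb andbT /A supp_perm.
  have I0 : 0 < #|I g| by apply: leq_trans leDI; apply/card_gt0P; exists a.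
  have I1 : #|I g| != 1%N.
    by apply: contra no1 => I1; apply/exists_inP; exists g.
  have A3 : (#|A| <= 3 * #|I g|)%N.
    rewrite defI; apply: leq_trans (card_supp_comm _ _); apply: minx.
    have Gy : x ^ g^-1 \in G by rewrite groupJ ?groupV.
    apply/andP; split; first exact: groupM (groupVr (groupM Gx Gy)) (groupM Gy Gx).
    rewrite -eq_mulVg1; apply/eqP=> /permP/(_ a).
    rewrite (permM x) (permM (x ^ g^-1)) => E.
    move: Da; rewrite inE => /and3P[_ ga gxa].
    have fa : (x ^ g^-1) a = a.
      by apply/eqP; move: ga; rewrite -suppJV inE negbK.
    by move: gxa; rewrite -suppJV inE E fa eqxx.
  by move: leDI A3 I0 I1; case: #|I g| => // -[|k] //= leDI A3 _ _; nia.
have T1 : 1 < #|T| by lia.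
have [w w0 cntw] := trans2_count G2 T1.
pose P1 := [set (a, x a) | a in A]; pose Q1 := setX (~: A) A.
have sumI : \sum_(g in G) (#|I g| * #|I g|.-1)%N = ((#|A| * #|A|.-1) * (#|A| * #|A|.-1) * w)%N.
  rewrite -!card_offdiag -cntw; last first.
  - by apply/subsetP=> p; rewrite !inE => /and3P[].
  - by apply/subsetP=> p; rewrite !inE => /and3P[].
  apply: eq_bigr => g Gg; rewrite -card_offdiag; congr #|pred_of_set _|.
  apply/setP=> -[a b]; rewrite !inE /= (inj_eq perm_inj).
  by do 5!case: (_ != _).
have sumD : \sum_(g in G) #|D g| = (#|A| * (#|~: A| * #|A|) * w)%N.
  have cP1 : #|P1| = #|A| by rewrite card_imset // => a b [].
  rewrite -cardsX -cP1 -cntw; last first.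
  - apply/subsetP=> -[a b]; rewrite !inE /= => /andP[Aa Ab].
    by apply: contraNneq Aa => ->.
  - apply/subsetP=> _ /imsetP[a Aa ->]; rewrite !inE /=.
    by rewrite /A inE eq_sym in Aa.
  apply: eq_bigr => g Gg.
  have inj1 : injective (fun a => (a, x a)) by move=> a b [].
  rewrite -(card_imset _ inj1); congr #|pred_of_set _|.
  apply/setP=> p; apply/imsetP/idP=> [[a Da ->] | ].
    move: Da; rewrite !in_set /= => /and3P[Aa nga ga].
    by rewrite nga ga imset_f ?in_set.
  rewrite inE => /andP[/imsetP[a Aa ->] /=]; rewrite inE /= in_setC => Dg.
  by exists a => //; rewrite inE Aa.
have : \sum_(g in G) (#|A| * #|D g|)%N <= \sum_(g in G) (6 * (#|I g| * #|I g|.-1))%N.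
  by apply: leq_sum => g; apply: key.
rewrite -!big_distrr /= sumI sumD.
have := cardsC A; move: le_A A0 w0.
move: #|A| #|~: A| #|T| => s r n le_s s0 w0 def_n.
(* After cancellation the averaged inequality is s r <= 6 (s - 1)^2, where r >= 6 s because 7 s <=
   |T|: a contradiction. *)
subst n; rewrite !mulnA (leq_pmul2r w0) => le6.
have : (s * s * (s * r) <= s * s * (6 * (s.-1 * s.-1)))%N by nia.
rewrite leq_pmul2l ?muln_gt0 ?s0 // => le7.
by exfalso; nia.
Qed.

(** * Jordan sets and blocks *)

Lemma imset_permM (T : finType) (g h : {perm T}) (S : {set T}) :
  (g * h) @: S = h @: (g @: S).
Proof. by rewrite -imset_comp; apply: eq_imset => z; rewrite permM. Qed.

(** For a group G: the pointwise stabiliser of the complement of S is transitive on S. *)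
Definition jordan (T : finType) (G : {set {perm T}}) (S : {set T}) :=
  forall x y, x \in S -> y \in S ->
    exists2 g, g \in G & g x = y /\ forall z, z \notin S -> g z = z.

Lemma jordanS (T : finType) (G H : {set {perm T}}) (S : {set T}) :
  G \subset H -> jordan G S -> jordan H S.
Proof.
move=> /subsetP sGH jS x y Sx Sy; have [g Gg gxy] := jS x y Sx Sy.
by exists g; first exact: sGH.
Qed.

Lemma jordanU (T : finType) (G : {group {perm T}}) (S1 S2 : {set T}) (p : T) :
  jordan G S1 -> jordan G S2 -> p \in S1 -> p \in S2 -> jordan G (S1 :|: S2).
Proof.
move=> j1 j2 p1 p2.
have to_p x : x \in S1 :|: S2 ->
    exists2 g, g \in G & g x = p /\ forall z, z \notin S1 :|: S2 -> g z = z.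
  case/setUP=> [xS | xS]; [have := j1 x p xS p1 | have := j2 x p xS p2];
    by case=> g Gg [gx gz]; exists g => //; split=> // z;
      rewrite inE negb_or => /andP[z1 z2]; apply: gz.
move=> x y /to_p[g Gg [gx gz]] /to_p[h Gh [hy hz]].
exists (g * h^-1); first by rewrite groupM ?groupV.
split=> [|z zN]; first by rewrite permM gx -hy permK.
by rewrite permM gz // -{1}(hz z zN) permK.
Qed.

Lemma jordanJ (T : finType) (G : {group {perm T}}) (S : {set T}) (g : {perm T}) :
  g \in G -> jordan G S -> jordan G (g @: S).
Proof.
move=> Gg jS _ _ /imsetP[x Sx ->] /imsetP[y Sy ->].
have [h Gh [hx hz]] := jS x y Sx Sy; exists (h ^ g); first by rewrite groupJ.
split=> [|z]; first by rewrite permJ hx.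
rewrite -{1 2}(permKV g z) mem_imset ?permJ; last exact: perm_inj.
by move=> zN; rewrite (hz _ zN) permKV.
Qed.

Definition block (T : finType) (G : {set {perm T}}) (B : {set T}) :=
  forall g x, g \in G -> x \in B -> g x \in B -> g @: B = B.

Lemma blockJ (T : finType) (G : {group {perm T}}) (B : {set T}) (g : {perm T}) :
  g \in G -> block G B -> block G (g @: B).
Proof.
move=> Gg bB h _ Gh /imsetP[x Bx ->].
have -> : h (g x) = g ((g * h * g^-1) x) by rewrite !permM permKV.
rewrite mem_imset => [Bgx|]; last exact: perm_inj.
have Ggh : g * h * g^-1 \in G by rewrite !groupM ?groupV.
by rewrite -{2}(bB _ x Ggh Bx Bgx) -!imset_permM mulgKV.
Qed.

(** Otherwise an element moving x to a point of S outside B, and fixing a point of B outside S,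
    would both preserve B and move x out of it. *)
Lemma block_jordan (T : finType) (G : {set {perm T}}) (B S : {set T}) (x : T) :
  block G B -> jordan G S -> x \in B -> x \in S -> (S \subset B) || (B \subset S).
Proof.
move=> bB jS Bx Sx; apply/norP=> -[/subsetPn[y Sy By] /subsetPn[z Bz Sz]].
have [g Gg [gx gz]] := jS x y Sx Sy; have := bB g z Gg Bz.
by rewrite gz // => /(_ Bz) gB; rewrite -gx -{1}gB imset_f in By.
Qed.

(** The translates of B contained in S partition S. *)
Lemma block_jordan_dvdn (T : finType) (G : {group {perm T}}) (B S : {set T}) (x : T) :
  block G B -> jordan G S -> x \in B -> B \subset S -> #|B| %| #|S|.
Proof.
move=> bB jS Bx sBS.
pose P := [set g @: B | g : {perm T} in [set g in G | (g : {perm T}) @: B \subset S]].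
suff defP : partition P S.
  rewrite (@card_uniform_partition _ #|B| P S) ?dvdn_mull // => _ /imsetP[g _ ->].
  exact/card_imset/perm_inj.
apply/and3P; split.
- rewrite eqEsubset; apply/andP; split.
    by apply/bigcupsP=> _ /imsetP[g + ->]; rewrite inE => /andP[].
  apply/subsetP=> y Sy; have [g Gg [gx gz]] := jS x y (subsetP sBS x Bx) Sy.
  apply/bigcupP; exists (g @: B); last by rewrite -gx imset_f.
  apply: imset_f; rewrite inE Gg; apply/subsetP=> _ /imsetP[z Bz ->].
  apply: contraT => gzS; have := gz _ gzS; move/perm_inj => gzz.
  by rewrite gzz (subsetP sBS) in gzS.
- apply/trivIsetP=> _ _ /imsetP[g + ->] /imsetP[h + ->].
  rewrite !inE => /andP[Gg _] /andP[Gh _]; apply: contraR => /pred0Pn[z /=].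
  case/andP=> /imsetP[u Bu ->] /imsetP[v Bv guv]; apply/eqP.
  have Ggh : g * h^-1 \in G by rewrite groupM ?groupV.
  have Bgu : (g * h^-1) u \in B by rewrite permM guv permK.
  by rewrite -{2}(bB _ u Ggh Bu Bgu) -imset_permM mulgKV.
- apply/imsetP=> -[g _ /esym/eqP]; rewrite imset_eq0 => /eqP B0.
  by rewrite B0 inE in Bx.
Qed.

(* If S is a proper Jordan set of maximal size, then a conjugate that meets S  *)
(* and does not cover T together with S must equal S; hence S or its           *)
(* complement is a block, unless the complement is a single point.             *)
Lemma jordan_primitive_trans2 (T : finType) (G : {group {perm T}}) (S : {set T}) :
  (forall x y, exists2 g, g \in G & g x = y) ->
  (forall B, block G B -> #|B| <= 1 \/ B = setT) ->
  jordan G S -> 1 < #|S| -> S \proper setT -> trans2 G.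
Proof.
move=> tG prG; have [i] := ubnP #|~: S|; elim: i S => // i IHi S.
rewrite ltnS => le_i jS S1 pS.
have C0 : 0 < #|~: S|.
  by have := cardsC S; have := proper_card pS; rewrite cardsT; lia.
have [C1 | C1] := eqVneq #|~: S| 1%N.
  have /cards1P[p defC] := introT eqP C1.
  have inS z : (z \in S) = (z != p) by rewrite -[S]setCK defC !inE.
  move=> a b c d ab cd; have [g Gg ga] := tG a p; have [h Gh hc] := tG c p.
  have [||k Gk [kb kp]] := jS (g b) (h d).
  - by rewrite inS -ga (inj_eq perm_inj) eq_sym.
  - by rewrite inS -hc (inj_eq perm_inj) eq_sym.
  exists (g * k * h^-1); first by rewrite !groupM ?groupV.
  rewrite !permM kb permK ga kp ?inS ?eqxx //; split=> //.
  by rewrite -hc permK.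
have [/exists_inP[g Gg /and3P[/set0Pn[p /setIP[Sp gSp]] nT nS]] | noS] :=
  boolP [exists g in G, [&& S :&: (g : {perm T}) @: S != set0,
     S :|: (g : {perm T}) @: S != setT & ~~ ((g : {perm T}) @: S \subset S)]].
  apply: (IHi (S :|: g @: S)).
  - rewrite (leq_trans _ le_i) // proper_card // properC /proper subsetUl /=.
    by rewrite subUset subxx.
  - by apply: jordanU Sp gSp; last exact: jordanJ.
  - by rewrite (leq_trans S1) ?subset_leq_card ?subsetUl.
  - by rewrite properEneq nT subsetT.
have fixS (g : {perm T}) : g @: S \subset S -> g @: S = S.
  by move=> sgS; apply/eqP; rewrite eqEcard sgS (card_imset _ (@perm_inj _ g)) /=.
have altS (g : {perm T}) p q : g \in G -> p \in S -> p \in g @: S ->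
    q \notin S -> q \notin g @: S -> g @: S = S.
  move=> Gg Sp gSp qS qgS; apply: fixS; apply: contraR noS => ngS.
  apply/exists_inP; exists g => //; rewrite ngS andbT; apply/andP; split.
    by apply/set0Pn; exists p; rewrite inE Sp.
  by apply/eqP=> /setP/(_ q); rewrite !inE (negPf qS) (negPf qgS).
have nSgS (g : {perm T}) : (#|S :|: g @: S| + #|S :&: g @: S| = 2 * #|S|)%N.
  by rewrite cardsUI (card_imset _ (@perm_inj _ g)) mul2n addnn.
have defn := cardsC S.
(* If S is at most half of T, a translate meeting S cannot cover T with it, so S is a block. If S is
   more than half, every translate meets S, and the same alternative makes the complement a
   block. *)
have [le2 | lt2] := leqP (2 * #|S|) #|T|.
  have /prG[|ST] : block G S.
  - move=> g x Gg Sx Sgx; have gSx : g x \in g @: S by rewrite imset_f.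
    have [q qN] : exists q, q \notin S :|: g @: S.
      apply/existsP; rewrite -negb_forall; apply/negP=> /forallP allU.
      have : #|S :&: g @: S| > 0 by apply/card_gt0P; exists (g x); rewrite inE Sgx.
      have : #|S :|: g @: S| = #|T|.
        by rewrite -cardsT; congr #|pred_of_set _|; apply/setP=> z; rewrite allU inE.
      by have := nSgS g; lia.
    rewrite inE negb_or in qN; case/andP: qN => qS qgS.
    exact: altS gSx qS qgS.
  - by rewrite leqNgt S1.
  - by rewrite ST properxx in pS.
have /prG[| CT] : block G (~: S).
- move=> g x Gg; rewrite !in_setC => Sx Sgx.
  have gSx : g x \notin g @: S by rewrite mem_imset //; apply: perm_inj.
  have [p /setIP[Sp gSp]] : exists p, p \in S :&: g @: S.
    apply/card_gt0P; have := max_card (S :|: g @: S); have := nSgS g.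
    by rewrite -cardsT cardsT; lia.
  by rewrite -preim_permV preimsetC preim_permV (altS g p (g x)).
- by case: #|~: S| C0 C1 => [|[]].
- have /card_gt0P[p Sp] : 0 < #|S| by apply: ltnW.
  by have := in_setT p; rewrite -CT inE Sp.
Qed.

(** In the application K and M are the cycles of x of lengths k and m; only what the block argument
    needs is kept. *)
Definition marked (T : finType) (x : {perm T}) (K M : {set T}) :=
  [/\ x @: K = K, jordan <[x]> K, jordan <[x]> M, coprime #|K| #|M|
    & 1 < #|K| < #|M|].

(** A translate of B meeting K either contains K, and is then x-invariant, or lies in K, so that |B|
    divides |K|. In the second case a translate meeting M is too small to contain M, so |B| also
    divides |M|, and coprimality forces |B| = 1. *)
Lemma marked_block (T : finType) (G : {group {perm T}}) (x : {perm T}) (K M B : {set T}) :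
  (forall a b, exists2 g, g \in G & g a = b) ->
  x \in G -> marked x K M -> block G B -> 1 < #|B| ->
  exists2 S : {set T}, x @: S = S & #|S| = #|B|.
Proof.
move=> tG Gx [xK jK jM coKM /andP[K1 ltKM]] bB B1.
have sxG : <[x]> \subset G by rewrite cycle_subG.
have {}jK := jordanS sxG jK; have {}jM := jordanS sxG jM.
have /card_gt0P[b Bb] : 0 < #|B| by apply: ltnW.
have translate (S : {set T}) : 0 < #|S| -> exists2 B', block G B' &
    #|B'| = #|B| /\ exists2 a, a \in S & a \in B'.
  case/card_gt0P=> a Sa; have [g Gg gb] := tG b a; exists (g @: B).
    exact: blockJ.
  split; first by apply/card_imset/perm_inj.
  by exists a; rewrite // -gb imset_f.
have [B1' bB1 [cB1 [a Ka B1a]]] := translate K (ltnW K1).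
have /orP[sKB | sBK] := block_jordan bB1 jK B1a Ka.
  exists B1' => //; apply: bB1 B1a _ => //.
  by apply: (subsetP sKB); rewrite -xK imset_f.
have [B2 bB2 [cB2 [c Mc B2c]]] := translate M (ltn_trans (ltnW K1) ltKM).
have /orP[sMB | sBM] := block_jordan bB2 jM B2c Mc.
  have := subset_leq_card sMB; have := subset_leq_card sBK.
  by rewrite cB1 cB2; lia.
have := block_jordan_dvdn bB1 jK B1a sBK.
have := block_jordan_dvdn bB2 jM B2c sBM.
rewrite cB1 cB2 => dM dK; have : #|B| %| gcdn #|K| #|M| by rewrite dvdn_gcd dK.
by rewrite (eqP coKM) dvdn1 => /eqP B_1; rewrite B_1 in B1.
Qed.

Lemma marked_pair_Alt (T : finType) (x y : {perm T}) (K M K' M' : {set T}) :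
  marked x K M -> marked y K' M' -> (7 * #|K| <= #|T|)%N ->
  (forall S S' : {set T}, x @: S = S -> y @: S' = S' -> #|S| = #|S'| ->
     #|S| = 0%N \/ #|S| = #|T|) ->
  'Alt_T \subset <<[set x; y]>>.
Proof.
move=> mx my K7 sum_free; set G := <<[set x; y]>>%G.
have Gx : x \in G by rewrite mem_gen ?set21.
have Gy : y \in G by rewrite mem_gen ?set22.
have [xK jK _ _ /andP[K1 _]] := mx.
have tG a b : exists2 g, g \in G & g a = b.
  pose S := orbit 'P G a.
  have inv g : g \in G -> g @: S = S.
    move=> Gg; apply/eqP; rewrite eqEcard card_imset ?leqnn ?andbT; last exact: perm_inj.
    by apply/subsetP=> _ /imsetP[c Sc ->]; rewrite -[g c]/('P%act c g) orbit_actr.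
  have S0 : #|S| != 0 by rewrite -lt0n; apply/card_gt0P; exists a; apply: orbit_refl.
  case: (sum_free S S (inv x Gx) (inv y Gy) erefl) => [S_0 | ST]; first by rewrite S_0 in S0.
  have : b \in S.
    suff -> : S = setT by rewrite inE.
    by apply/eqP; rewrite eqEcard subsetT cardsT ST /=.
  by case/orbitP=> g Gg <-; exists g.
have G2 : trans2 G.
  apply: (@jordan_primitive_trans2 _ _ K) => //.
  - move=> B bB; have [B1 | B1] := leqP #|B| 1; first by left.
    have [S xS cS] := marked_block tG Gx mx bB B1.
    have [S' yS cS'] := marked_block tG Gy my bB B1.
    have [B0 | BT] := sum_free S S' xS yS (etrans cS (esym cS')).
      by rewrite -cS B0 in B1.
    by right; apply/eqP; rewrite eqEcard subsetT cardsT -cS BT /=.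
  - by apply: jordanS jK; rewrite cycle_subG.
  - by rewrite properEcard subsetT cardsT; lia.
have /card_gt0P[a Ka] : 0 < #|K| by apply: ltnW.
have [b] : exists b, b \in K :\ a.
  by apply/card_gt0P; move: K1; rewrite (cardsD1 a) Ka.
rewrite !inE => /andP[ba Kb].
have [z xz [zab zfix]] := jK a b Ka Kb.
apply: (trans2_small_supp_Alt G2 (_ : z \in G)).
- by apply: subsetP xz; rewrite cycle_subG.
- by apply: contraNneq ba => z1; rewrite -zab z1 perm1.
- apply: leq_trans K7; rewrite leq_mul2l /=; apply/subset_leq_card/subsetP=> u.
  by rewrite inE; apply: contraR => /zfix->.
Qed.

(** * Permutations with prescribed cycle lengths *)

(** Permutations are built from a colouring [c] of the points: the fibres of [c] are to be the
    cycles, so prescribing cycle lengths means prescribing fibre sizes. *)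
Definition fiber (T U : finType) (c : T -> U) (v : U) : {set T} := [set x | c x == v].

Lemma exists_card_fibers (T U : finType) (w : U -> nat) :
  \sum_v w v = #|T| -> exists c : T -> U, forall v, #|fiber c v| = w v.
Proof.
move=> sumw; pose V := {v : U & 'I_(w v)}.
have cardV : #|T| = #|{: V}|.
  by rewrite card_tagged sumnE big_map big_enum -sumw; apply: eq_bigr => v _; rewrite card_ord.
pose f (x : T) : V := enum_val (cast_ord cardV (enum_rank x)).
have f_inj : injective f by move=> x y /enum_val_inj/cast_ord_inj/enum_rank_inj.
have f_bij := inj_card_bij f_inj (eq_leq (esym cardV)).
exists (fun x => tag (f x)) => v.
rewrite -[RHS]card_ord -cardsT -(card_imset _ f_inj).
have inj_tag : injective (fun i : 'I_(w v) => Tagged (fun u => 'I_(w u)) i).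
  by move=> i j /eqP; rewrite eq_Tagged => /eqP.
rewrite -(card_imset [set: 'I_(w v)] inj_tag); congr #|pred_of_set _|.
have [h fK hK] := f_bij.
apply/setP=> t; apply/imsetP/imsetP=> [[x] | [j _ ->]].
  rewrite inE => /eqP + ->; case: (f x) => u i /= eq_uv.
  by move: i; rewrite eq_uv => i; exists i; rewrite ?inE.
by exists (h (existT _ v j)); rewrite ?inE ?hK.
Qed.

Lemma exists_perm_fibers (T U : finType) (c : T -> U) :
  exists g : {perm T}, forall x, porbit g x = fiber c (c x).
Proof.
pose p v := enum (fiber c v).
have p_uniq v : uniq (p v) by apply: enum_uniq.
have mem_p v x : (x \in p v) = (c x == v) by rewrite mem_enum inE.
have c_next v x : c x == v -> c (next (p v) x) == v by rewrite -!mem_p mem_next.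
have next_inj : injective (fun x => next (p (c x)) x).
  move=> x y eq_xy; have eqc : c x = c y.
    by rewrite -(eqP (c_next _ _ (eqxx (c x)))) eq_xy (eqP (c_next _ _ (eqxx (c y)))).
  by rewrite -[x](prev_next (p_uniq (c x))) eq_xy eqc prev_next.
exists (perm next_inj) => x; apply/setP=> y; rewrite inE.
have px : x \in p (c x) by rewrite mem_p.
have cyc : fcycle (perm next_inj) (p (c x)).
  have := cycle_next (p_uniq (c x)); apply: sub_in_cycle; last first.
    by apply/allP=> z pz; exact: pz.
  move=> a b; rewrite -!topredE /= !mem_p => /eqP ca _ /=.
  by rewrite permE ca.
rewrite -mem_p -(fconnect_cycle cyc px).
apply/porbitP/idP=> [[i ->] | /iter_findex <-]; first by rewrite permX fconnect_iter.
by eexists; rewrite -permX.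
Qed.

Lemma card_porbits_fiber (T U : finType) (c : T -> U) (g : {perm T}) :
  (forall x, porbit g x = fiber c (c x)) -> (forall v, 0 < #|fiber c v|) ->
  #|porbits g| = #|U|.
Proof.
move=> gc c0; have c_onto v : exists x, c x = v.
  by have /card_gt0P[x] := c0 v; rewrite inE => /eqP; exists x.
have fiber_inj : injective (fiber c).
  move=> u v eq_uv; have [x cx] := c_onto u.
  have : x \in fiber c v by rewrite -eq_uv inE cx.
  by rewrite inE cx => /eqP.
rewrite -cardsT -(card_imset _ fiber_inj); congr #|pred_of_set _|.
apply/setP=> S; apply/imsetP/imsetP=> [[x _ ->] | [v _ ->]].
  by exists (c x); rewrite ?inE.
by have [x <-] := c_onto v; exists x.
Qed.

Lemma card_invariant_fiber (T U : finType) (c : T -> U) (g : {perm T}) (S : {set T}) :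
  (forall x, porbit g x = fiber c (c x)) -> g @: S = S ->
  #|S| = \sum_(v in c @: S) #|fiber c v|.
Proof.
move=> gc gS; have gX i x : x \in S -> (g ^+ i) x \in S.
  by move=> Sx; elim: i => [|i IHi]; rewrite ?expg0 ?perm1 // expgSr permM -gS imset_f.
have memS x : x \in S = (c x \in c @: S).
  apply/idP/imsetP=> [Sx | [y Sy eq_c]]; first by exists x.
  have : x \in porbit g y by rewrite gc inE eq_c.
  by case/porbitP=> i ->; apply: gX.
rewrite -sum1_card (partition_big c (fun v => v \in c @: S)) /=; last first.
  by move=> x; rewrite memS.
apply: eq_bigr => v cSv; rewrite -sum1_card; apply: eq_bigl => x.
by rewrite !inE memS; case: eqP => [-> | _]; rewrite ?cSv ?andbF.
Qed.

Lemma fiber_invariant (T U : finType) (c : T -> U) (g : {perm T}) (v : U) :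
  (forall x, porbit g x = fiber c (c x)) -> g @: fiber c v = fiber c v.
Proof.
move=> gc; apply/eqP; rewrite eqEcard (card_imset _ (@perm_inj _ g)) leqnn andbT.
apply/subsetP=> _ /imsetP[x + ->]; rewrite !inE => /eqP <-.
by have := mem_porbit g 1 x; rewrite gc inE.
Qed.

(** By the Chinese remainder theorem some power of g acts on this cycle as any given power of g and
    trivially on all the others. *)
Lemma fiber_jordan (T U : finType) (c : T -> U) (g : {perm T}) (v : U) :
  (forall x, porbit g x = fiber c (c x)) ->
  (forall u, u != v -> coprime #|fiber c v| #|fiber c u|) ->
  jordan <[g]> (fiber c v).
Proof.
move=> gc co_v x y; rewrite !inE => /eqP cx /eqP cy.
have : y \in porbit g x by rewrite gc inE cx cy.
case/porbitP=> i ->; pose w := (\prod_(u | u != v) #|fiber c u|)%N.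
have co_w : coprime #|fiber c v| w 
  by apply: (big_ind (coprime _)) => [|a b ca cb|//]; rewrite ?coprimen1 ?coprimeMr ?ca.
pose q := chinese #|fiber c v| w i 0.
have modX z j k : j = k %[mod #|porbit g z|] -> (g ^+ j) z = (g ^+ k) z.
  have red a : (g ^+ a) z = (g ^+ (a %% #|porbit g z|)) z.
    rewrite {1}(divn_eq a #|porbit g z|) expgD mulnC expgM permM; congr (_ _).
    by apply: permX_fix; rewrite permX iter_porbit.
  by move=> eq_jk; rewrite red eq_jk -red.
exists (g ^+ q); first exact: mem_cycle.
split=> [|z]; first by apply: modX; rewrite gc cx; apply: chinese_modl.
rewrite inE => cz; rewrite -[RHS](@perm1 T) -(expg0 g); apply: modX.
have dvd_w : #|porbit g z| %| w by rewrite gc /w (bigD1 (c z)) //= dvdn_mulr.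
by rewrite -(modn_dvdm _ dvd_w) chinese_modr // (modn_dvdm _ dvd_w).
Qed.

Lemma exists_marked_perm (T : finType) (k l m e : nat) :
  (k + e * l + m)%N = #|T| -> 1 < k < m -> 0 < l ->
  coprime k l -> coprime k m -> coprime l m ->
  exists g : {perm T}, exists K, exists M,
    [/\ marked g K M, #|K| = k, odd_perm g = odd #|T| (+) odd e
      & forall S : {set T}, g @: S = S -> exists a : bool, exists j, exists b : bool,
        j <= e /\ #|S| = (a * k + j * l + b * m)%N].
Proof.
move=> def_n /andP[k1 ltkm] l0 co_kl co_km co_lm.
(* Colours: [inl] for the e cycles of length l, [inr true] for the cycle of length k, [inr false]
   for that of length m. *)
pose w (v : 'I_e + bool) := match v with inl _ => l | inr b => if b then k else m end.
have sum_w (V : {set 'I_e + bool}) : \sum_(v in V) w v =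
   ((inr true \in V) * k + #|[set i | inl i \in V]| * l + (inr false \in V) * m)%N.
  rewrite big_mkcond big_sumType /= big_bool /=.
  rewrite -big_mkcond sum_nat_const.
  rewrite (_ : #|_| = #|[set i | inl i \in V]|); last by rewrite cardsE.
  rewrite addnCA addnA; congr (_ + _ + _)%N;
    by case: (_ \in V); rewrite ?mul1n ?mul0n.
have [|c cw] := @exists_card_fibers T _ w.
  rewrite (eq_bigl (fun v => v \in [set: 'I_e + bool])) => [|v]; last by rewrite inE.
  rewrite sum_w !inE /= !mul1n -def_n; congr (_ + _ * _ + _)%N.
  by rewrite -[RHS]card_ord; apply: eq_card => i; rewrite !inE.
have [g gc] := exists_perm_fibers c.
exists g, (fiber c (inr true)), (fiber c (inr false)); split.
- split; rewrite ?cw ?k1 //; first exact: fiber_invariant.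
    by apply: fiber_jordan => // -[i | []] // _; rewrite !cw.
  by apply: fiber_jordan => // -[i | []] // _; rewrite !cw coprime_sym.
- by rewrite cw.
- rewrite /odd_perm (card_porbits_fiber gc) => [|[i|[]]]; rewrite ?cw //; last 2 first.
  + exact: ltnW.
  + by apply: leq_trans ltkm; rewrite ltnS.
  by rewrite card_sum card_ord card_bool addn2 /= negbK.
- move=> S gS; exists (inr true \in c @: S), #|[set i | inl i \in c @: S]|.
  exists (inr false \in c @: S); split; first by rewrite -[e in _ <= e]card_ord max_card.
  rewrite (card_invariant_fiber gc gS) -sum_w; exact: eq_bigr.
Qed.

(** * The lower bound for kappa *)

Lemma markedJ (T : finType) (x a : {perm T}) (K M : {set T}) :
  marked x K M -> marked (x ^ a) (a @: K) (a @: M).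
Proof.
have jJ S : jordan <[x]> S -> jordan <[x ^ a]> (a @: S).
  move=> jS _ _ /imsetP[u Su ->] /imsetP[v Sv ->].
  have [g xg [gu gz]] := jS u v Su Sv; exists (g ^ a); first by rewrite cycleJ memJ_conjg.
  split=> [|z]; first by rewrite permJ gu.
  rewrite -{1 2}(permKV a z) (mem_imset _ _ (@perm_inj _ a)) permJ.
  by move=> zN; rewrite (gz _ zN) permKV.
case=> xK jK jM co lt; split; rewrite ?(card_imset _ (@perm_inj _ a)) //; try exact: jJ.
by rewrite -imset_permM -conjgC imset_permM xK.
Qed.

(* Of the e cycles of length l only the sizes of invariant sets are recorded.  *)
Definition lengths_perm (T : finType) (k l m e : nat) (x : {perm T}) :=
  exists K, exists M, [/\ marked x K M, #|K| = k
    & forall S : {set T}, x @: S = S -> exists a : bool, exists i, exists b : bool,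
        i <= e /\ #|S| = (a * k + i * l + b * m)%N].

Lemma lengths_permJ (T : finType) (k l m e : nat) (x a : {perm T}) :
  lengths_perm k l m e x -> lengths_perm k l m e (x ^ a).
Proof.
case=> K [M [mx cK invx]]; exists (a @: K), (a @: M); split; first exact: markedJ.
  by rewrite (card_imset _ (@perm_inj _ a)).
move=> S xS; have : x @: (a^-1 @: S) = a^-1 @: S.
  by rewrite -[in RHS]xS -!imset_permM conjgE !mulgA mulgK.
by case/invx=> b [i [b' [le_i]]]; rewrite (card_imset _ (@perm_inj _ _)); exists b, i, b'.
Qed.

(** A set containing the m-cycle has more than n / 2 points and any other invariant set fewer, so S
    and S' both contain it or both avoid it. If both avoid it, their sizes are equal small sums,
    hence 0; if both contain it, the same applies to the complements. *)
Lemma lengths_sum_free (n e N : nat) (I : {set 'I_N * 'I_N}) (p q : 'I_N * 'I_N)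
  (x y : 'S_n) (S S' : {set 'I_n}) :
  e <= 2 -> (20 * N <= n)%N -> 1 < N ->
  (forall p q (a b : bool) (i j : nat), p \in I -> q \in I -> i <= 2 -> j <= 2 ->
     a + i > 0 -> b + j > 0 ->
     (a * len1 p + i * len2 p = b * len1 q + j * len2 q)%N -> p = q) ->
  p \in I -> q \in I -> p != q ->
  lengths_perm (len1 p) (len2 p) (n - len1 p - e * len2 p) e x ->
  lengths_perm (len1 q) (len2 q) (n - len1 q - e * len2 q) e y ->
  x @: S = S -> y @: S' = S' -> #|S| = #|S'| -> #|S| = 0%N \/ #|S| = n.
Proof.
move=> e2 le_Nn N1 sumf Ip Iq npq [K [M [mx cK invx]]] [K' [M' [my cK' invy]]] xS yS'.
have [a [i [b [le_i ->]]]] := invx S xS; have [a' [j [b' [le_j ->]]]] := invy S' yS'.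
have free (a1 b1 : bool) i1 j1 : i1 <= 2 -> j1 <= 2 ->
    (a1 * len1 p + i1 * len2 p = b1 * len1 q + j1 * len2 q)%N ->
    (a1 * len1 p + i1 * len2 p = 0)%N.
  move=> i12 j12 eq_f; have [ai | ] := posnP (a1 + i1).
    by move/eqP: ai; rewrite addn_eq0 => /andP[/eqP-> /eqP->]; rewrite !mul0n.
  have [bj | bj ai] := posnP (b1 + j1).
    by rewrite eq_f => _; move/eqP: bj; rewrite addn_eq0 => /andP[/eqP-> /eqP->]; rewrite !mul0n.
  by move/eqP: npq; case; apply: sumf eq_f.
have lens (r : 'I_N * 'I_N) : len1 r <= 2 * N + 1 /\ len2 r <= 2 * N + 1.
  by have := ltn_ord r.1; have := ltn_ord r.2; rewrite /len1 /len2; lia.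
have small (r : 'I_N * 'I_N) : (2 * (len1 r + e * len2 r) < n)%N.
  have [r1 r2] := lens r; have : (e * len2 r <= 2 * (2 * N + 1))%N by apply: leq_mul.
  by lia.
have part (r : 'I_N * 'I_N) (c : bool) t : t <= e ->
    (c * len1 r + t * len2 r + (~~ c * len1 r + (e - t) * len2 r) = len1 r + e * len2 r)%N.
  move=> le_t; rewrite mulnBl; have := leq_mul le_t (leqnn (len2 r)).
  by case: c; rewrite /= !mul0n !mul1n; lia.
have le2 t : t <= e -> t <= 2 by move=> le_t; apply: leq_trans le_t e2.
have le2B t : e - t <= 2 by apply: leq_trans e2; apply: leq_subr.
have := free a a' i j (le2 i le_i) (le2 j le_j).
have := free (~~ a) (~~ a') (e - i) (e - j) (le2B i) (le2B j).
have := part p a i le_i; have := part q a' j le_j; have := small p; have := small q.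
move: (a * _ + i * _)%N (a' * _ + j * _)%N => f g.
move: (~~ a * _ + _ * _)%N (~~ a' * _ + _ * _)%N (e * _)%N (e * _)%N => f' g' el el'.
by case: b; case: b'; rewrite ?mul1n ?mul0n; clear; lia.
Qed.

Lemma kappa_ge (gT : finGroupType) (G : {group gT}) (X : {set {set gT}}) :
  pairwise_generating G X -> #|X| <= kappa G.
Proof. exact: (@leq_bigmax_cond _ _ (fun X : {set {set gT}} => #|X|)). Qed.

Lemma kappa_gt0 (gT : finGroupType) (G : {group gT}) : 0 < kappa G.
Proof.
apply: leq_trans (kappa_ge (X := [set 1 ^: G]) _); first by rewrite cards1.
rewrite /pairwise_generating sub1set mem_classes ?group1 //=.
apply/forall_inP=> C /set1P->; apply/forall_inP=> D /set1P->.
by rewrite eqxx.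
Qed.

Lemma kappa_lower_bound (n : nat) (G : {group 'S_n}) :
  G = ('Sym_('I_n))%G \/ G = ('Alt_('I_n))%G -> (20 * 361 <= n)%N ->
  (n <= 100 * 100 * kappa G)%N.
Proof.
move=> GSA n_big.
(* [s] is the parity of the elements to be used: odd for Sym(n), so that Alt(n) together with one of
   them gives all of G, and even for Alt(n). *)
have [s [sG defG]] : exists s : bool, (forall x : 'S_n, x \in G = (x ==> s)) /\
    (forall H : {group 'S_n}, 'Alt_('I_n) \subset H -> H \subset G ->
      forall x, x \in H -> odd_perm x = s -> H = G).
  case: GSA => ->; [exists true | exists false]; split=> [x | H sAH sHG x Hx odd_x].
  - by rewrite implybT inE.
  - apply/val_inj/eqP; rewrite eqEsubset sHG /=; apply/subsetP=> y _.
    have [oy | ey] := boolP (odd_perm y); last by apply: subsetP sAH _ _; rewrite Alt_even.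
    rewrite -(mulKVg x y) groupM //; apply: subsetP sAH _ _.
    by rewrite Alt_even odd_permM odd_permV odd_x oy.
  - by rewrite Alt_even implybF.
  - by apply/val_inj/eqP; rewrite eqEsubset sHG.
pose e := if odd n (+) s then 1%N else 2.
have e12 : 0 < e <= 2 by rewrite /e; case: (_ (+) _).
have odd_e : odd e = odd n (+) s by rewrite /e; case: (_ (+) _).
have [N [I [[N1 le_Nn] le_n coI sumf]]] := exists_lengths e12 n_big.
have lens (r : 'I_N * 'I_N) :
    len1 r <= 2 * N + 1 /\ 3 <= len1 r /\ len2 r <= 2 * N + 1 /\ 3 <= len2 r.
  by have := ltn_ord r.1; have := ltn_ord r.2; rewrite /len1 /len2; lia.
pose lp (p : 'I_N * 'I_N) (x : 'S_n) :=
  lengths_perm (len1 p) (len2 p) (n - len1 p - e * len2 p) e x.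
have [g gP] : exists g : 'I_N * 'I_N -> 'S_n, forall p, p \in I ->
    lp p (g p) /\ odd_perm (g p) = s.
  apply: (@fin_all_exists _ _ (fun p x => p \in I -> lp p x /\ odd_perm x = s)) => p.
  have [Ip | nIp] := boolP (p \in I); last by exists 1.
  have /and3P[co_kl co_km co_lm] := coI p Ip.
  have [le_k [k3 [le_l l3]]] := lens p.
  have le_el : (e * len2 p <= 2 * (2 * N + 1))%N by apply: leq_mul => //; case/andP: e12.
  have lt_n : (2 * (len1 p + e * len2 p) < n)%N by lia.
  have def_n : (len1 p + e * len2 p + (n - len1 p - e * len2 p) = #|'I_n|)%N.
    by rewrite card_ord; move: (e * _)%N lt_n => el; clear; lia.
  have lt_km : 1 < len1 p < n - len1 p - e * len2 p.
    by move: (e * _)%N lt_n k3 => el; clear; lia.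
  have l0 : 0 < len2 p by apply: leq_trans l3.
  have [x [K [M [mx cK odd_x invx]]]] :=
    exists_marked_perm def_n lt_km l0 co_kl co_km co_lm.
  exists x => _; split; first by exists K, M; split.
  by rewrite odd_x card_ord odd_e addKb.
have gG p : p \in I -> g p \in G by move=> /gP[_ odd_g]; rewrite sG odd_g implybb.
have conjP p x : p \in I -> x \in g p ^: G -> lp p x /\ odd_perm x = s.
  move=> Ip /imsetP[a _ ->]; have [lpg odd_g] := gP p Ip.
  by rewrite odd_permJ; split=> //; apply: lengths_permJ.
have free p q x y (S S' : {set 'I_n}) : p \in I -> q \in I -> p != q -> lp p x -> lp q y ->
    x @: S = S -> y @: S' = S' -> #|S| = #|S'| -> #|S| = 0%N \/ #|S| = n.
  by apply: lengths_sum_free => //; case/andP: e12.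
have K7 (p : 'I_N * 'I_N) : (7 * len1 p <= n)%N by have [+ _] := lens p; lia.
pose X := [set g p ^: G | p in I].
have cardX : #|X| = #|I|.
  (* If two pairs gave the same class, [g p] would have both kinds of cycle lengths, and its cycle K
     would be an invariant set of a common size strictly between 0 and n. *)
  apply: card_in_imset => p q Ip Iq eq_pq; apply/eqP; apply: contraT => npq.
  have [lpp _] := conjP p (g p) Ip (class_refl _ _).
  have [lpq _] : lp q (g p) /\ odd_perm (g p) = s.
    by apply: conjP => //; rewrite -eq_pq class_refl.
  have [K [M [mx cK _]]] := lpp; have [gK _ _ _ /andP[K1 _]] := mx.
  have := free p q _ _ K K Ip Iq npq lpp lpq gK gK erefl.
  by have := K7 p; rewrite -cK; lia.
apply: leq_trans le_n _; rewrite leq_mul2l -cardX kappa_ge ?orbT //.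
apply/andP; split.
  by apply/subsetP=> _ /imsetP[p Ip ->]; rewrite mem_classes ?gG.
apply/forall_inP=> _ /imsetP[p Ip ->]; apply/forall_inP=> _ /imsetP[q Iq ->].
apply/implyP=> neq; have npq : p != q by apply: contraNneq neq => ->.
apply/forall_inP=> x xp; apply/forall_inP=> y yq.
have [lpx odd_x] := conjP p x Ip xp; have [lqy _] := conjP q y Iq yq.
have [K [M [mx cK _]]] := lpx; have [K' [M' [my _ _]]] := lqy.
suff <- : <<[set x; y]>>%G = G by [].
apply: defG odd_x; last by rewrite mem_gen ?set21.
  apply: marked_pair_Alt mx my _ _; first by rewrite cK card_ord.
  by move=> S S' xS yS' eqS; rewrite card_ord; apply: free lpx lqy xS yS' eqS.
rewrite gen_subG; apply/subsetP=> z /set2P[] ->.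
  by move: xp => /imsetP[a Ga ->]; rewrite groupJ ?gG.
by move: yq => /imsetP[a Ga ->]; rewrite groupJ ?gG.
Qed.

(** * Normal coverings *)

Lemma kappa_le_gamma (gT : finGroupType) (G : {group gT}) :
  ~~ cyclic G -> kappa G <= gamma G.
Proof.
move=> ncG; have [[S covS <-] _] := gammaP ncG.
have /and3P[/forall_inP propS _ /eqP defG] := covS.
apply/bigmax_leqP=> X /andP[/subsetP sXG /forall_inP genX].
pose meets (C : {set gT}) (H : {group gT}) :=
  [exists g in G, C :&: H :^ g != set0].
pose f C := odflt 1%G [pick H in S | meets C H].
have fP C : C \in X -> f C \in S /\ meets C (f C).
  move=> XC; rewrite /f; case: pickP => [H /andP[] // | none].
  have /imsetP[x Gx defC] := sXG C XC; move: (Gx); rewrite {1}defG.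
  case/bigcupP=> H SH /bigcupP[g Gg Hgx]; have /negP[] := none H.
  rewrite SH; apply/exists_inP; exists g => //; apply/set0Pn; exists x.
  by rewrite inE Hgx defC class_refl.
rewrite -(@card_in_imset _ _ f); last first.
  move=> C D XC XD eq_f; apply/eqP; apply: contraT => neCD.
  have [SH /exists_inP[a Ga /set0Pn[x /setIP[Cx Hx]]]] := fP C XC.
  have [_ /exists_inP[b Gb /set0Pn[y /setIP[Dy Hy]]]] := fP D XD.
  rewrite -eq_f in Hy; set H := f C in SH Hx Hy.
  pose y' := y ^ (b^-1 * a).
  have Dy' : y' \in D.
    have /imsetP[d Gd defD] := sXG D XD; move: Dy; rewrite /y' defD => /imsetP[z Gz ->].
    by rewrite -conjgM memJ_class // !groupM ?groupV.
  have Hy' : y' \in H :^ a by rewrite /y' conjgM memJ_conjg -mem_conjg.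
  have /forall_inP/(_ D XD)/implyP/(_ neCD)/forall_inP/(_ x Cx)/forall_inP/(_ y' Dy')/eqP gen :=
    genX C XC.
  have : G \subset H :^ a.
    by rewrite -gen gen_subG; apply/subsetP=> z /set2P[] ->.
  by move/subset_leq_card; rewrite cardJg leqNgt proper_card ?propS.
by apply/subset_leq_card/subsetP=> _ /imsetP[C XC ->]; have [] := fP C XC.
Qed.

(** A list of covering subgroups may contain conjugate members; choosing one representative in each
    conjugacy class makes it a normal covering without lengthening it. *)
Lemma gamma_le_size (gT : finGroupType) (G : {group gT}) (s : seq {group gT}) :
  ~~ cyclic G -> (forall H, H \in s -> H \proper G) ->
  (forall x, x \in G -> exists2 H, H \in s & exists2 g, g \in G & x \in H :^ g) ->
  gamma G <= size s.
Proof.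
move=> ncG prop_s cov_s; have [_ le_gamma] := gammaP ncG.
pose rep (H : {group gT}) := odflt H [pick K in orbit 'JG G H].
have repP H : exists2 g, g \in G & rep H = (H :^ g)%G.
  rewrite /rep; case: pickP => [K /orbitP[g Gg <-] | _] /=; first by exists g.
  by exists 1; rewrite ?group1 //; apply/val_inj; rewrite /= conjsg1.
have rep_orbit H K : K \in orbit 'JG G H -> rep H = rep K.
  move=> HK; rewrite /rep (orbit_eqP HK).
  by case: pickP => // none; have := none H; rewrite /= orbit_refl.
pose S : {set {group gT}} := [set rep H | H in s].
suff covS : normal_covering G S.
  apply: leq_trans (le_gamma S covS) _.
  by apply: leq_trans (leq_imset_card _ _) _; apply: card_size.
apply/and3P; split.
- apply/forall_inP=> _ /imsetP[H sH ->]; have [g Gg ->] := repP H.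
  by rewrite -(conjGid Gg) /= properJ prop_s.
- apply/forall_inP=> _ /imsetP[H sH ->]; apply/forall_inP=> _ /imsetP[K sK ->].
  apply/implyP; apply: contra => /imsetP[g Gg eq_HK]; apply/eqP.
  have [a Ga eqa] := repP H; have [b Gb eqb] := repP K.
  apply: rep_orbit; apply/orbitP; exists (a * g * b^-1).
    by rewrite !groupM ?groupV.
  rewrite eqa eqb /= in eq_HK.
  by apply/val_inj; rewrite /= !conjsgM -eq_HK conjsgK.
- rewrite eqEsubset; apply/andP; split; apply/subsetP=> x.
    move=> Gx; have [H sH [g Gg Hgx]] := cov_s x Gx; have [a Ga eqa] := repP H.
    apply/bigcupP; exists (rep H); first exact: imset_f.
    apply/bigcupP; exists (a^-1 * g); first by rewrite groupM ?groupV.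
    by rewrite eqa /= -conjsgM mulKVg.
  case/bigcupP=> _ /imsetP[H sH ->] /bigcupP[g Gg]; have [a Ga ->] := repP H.
  apply: subsetP; rewrite -(conjGid (groupM Ga Gg)) /= -conjsgM conjSg.
  by apply/proper_sub/prop_s.
Qed.

(** * The upper bound for gamma *)

Lemma Alt_cycle3 (T : finType) (a b c : T) : uniq [:: a; b; c] -> cycle3 a b c \in 'Alt_T.
Proof.
move=> U3; have [ab ac] : a != b /\ a != c.
  by move: U3; rewrite /= !inE negb_or => /and3P[/andP[]].
by rewrite Alt_even odd_permM !odd_tperm ab ac.
Qed.

Lemma uniq_take_card (T : finType) (k : nat) : k <= #|T| ->
  exists s : seq T, uniq s /\ size s = k.
Proof.
move=> le_k; exists (take k (enum T)); rewrite take_uniq ?enum_uniq //.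
by rewrite size_takel // -cardE.
Qed.

Lemma Alt_not_cyclic (T : finType) (G : {group {perm T}}) :
  3 < #|T| -> 'Alt_T \subset G -> ~~ cyclic G.
Proof.
move/uniq_take_card=> [[|a [|b [|c [|d [|? ?]]]]] [Us sz]] // sAG.
apply/negP=> /cyclic_abelian/centsP/(_ (cycle3 a b c)) cGG.
have U1 : uniq [:: a; b; c] by have := take_uniq 3 Us.
have U2 : uniq [:: b; c; d] by have := drop_uniq 1 Us.
have := cGG _ (cycle3 b c d); rewrite !(subsetP sAG) ?Alt_cycle3 //.
move=> /(_ isT isT)/permP/(_ a); rewrite permM (permM (cycle3 b c d)).
have [Ea _ _ _] := cycle3E U1; have [Eb _ _ Ez] := cycle3E U2.
rewrite Ea Eb Ez ?Ea => [cb|]; last by case/andP: Us.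
by move: U2; rewrite /= cb inE eqxx.
Qed.

Lemma Sym_not_cyclic (T : finType) : 2 < #|T| -> ~~ cyclic 'Sym_T.
Proof.
move/uniq_take_card=> [[|a [|b [|c [|? ?]]]] [Us sz]] //.
have [ab [ac bc]] : a != b /\ a != c /\ b != c.
  by move: Us; rewrite /= !inE negb_or => /and3P[/andP[-> ->] ->].
apply/negP=> /cyclic_abelian/centsP/(_ (tperm a b)) cGG.
have := cGG _ (tperm a c); rewrite !inE => /(_ isT isT)/permP/(_ a).
rewrite !permM !tpermL (tpermD ac bc) (tpermD ab _) 1?eq_sym // => bc_eq.
by rewrite bc_eq eqxx in bc.
Qed.

Lemma exists_perm_imset (T : finType) (S S' : {set T}) :
  #|S| = #|S'| -> exists a : {perm T}, a @: S = S'.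
Proof.
have [k] := ubnP #|S :\: S'|; elim: k S => // k IHk S le_k eqS.
have [sSS' | ] := boolP (S \subset S').
  by exists 1; apply/eqP; rewrite imset_perm1 eqEcard sSS' eqS /=.
case/subsetPn=> u Su nS'u.
have [v S'v nSv] : exists2 v, v \in S' & v \notin S.
  apply/subsetPn; apply: contra nS'u => sS'S.
  by have /eqP-> : S' == S by rewrite eqEcard sS'S eqS /=.
have [||a def_S'] := IHk (tperm u v @: S).
- move: le_k; rewrite ltnS; apply: leq_trans; apply: proper_card; apply/properP; split.
    apply/subsetP=> _ /setDP[/imsetP[z Sz ->]].
    rewrite !inE; case: tpermP => [_ | zv | _ _ ->]; rewrite ?S'v ?Sz //.
    by rewrite -zv Sz in nSv.
  exists u; rewrite !inE ?Su ?nS'u //=; apply/imsetP=> -[z Sz].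
  case: tpermP => [_ uv | zv | zu _ uz]; first by rewrite uv S'v in nS'u.
    by rewrite -zv Sz in nSv.
  by case: zu.
- by rewrite (card_imset _ (@perm_inj _ _)).
- by exists (tperm u v * a); rewrite imset_permM.
Qed.

(** With more than two points, S or its complement has two points; their transposition preserves S
    and corrects the parity. *)
Lemma exists_Alt_imset (T : finType) (S S' : {set T}) :
  2 < #|T| -> #|S| = #|S'| -> exists2 a, a \in 'Alt_T & a @: S = S'.
Proof.
move=> T3 eqS; have [a aS] := exists_perm_imset eqS.
have [odd_a | even_a] := boolP (odd_perm a); last by exists a; rewrite // Alt_even.
have [u [v [uv /eqP tS]]] : exists u, exists v, u != v /\ tperm u v @: S == S.
  have card_ge (A : {set T}) : 1 < #|A| ->
      exists u, exists v, [/\ u \in A, v \in A & u != v].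
    by case/card_gt1P=> u [v [Au Av uv]]; exists u, v.
  have [S2 | S1] := ltnP 1 #|S|.
    have [u [v [Su Sv uv]]] := card_ge _ S2; exists u, v; split=> //.
    rewrite eqEcard (card_imset _ (@perm_inj _ _)) leqnn andbT.
    by apply/subsetP=> _ /imsetP[z Sz ->]; case: tpermP.
  have [|u [v [Su Sv uv]]] := card_ge (~: S); first by rewrite cardsCs setCK; lia.
  exists u, v; split=> //; rewrite eqEcard (card_imset _ (@perm_inj _ _)) leqnn andbT.
  rewrite !inE in Su Sv.
  apply/subsetP=> _ /imsetP[z Sz ->].
  by rewrite tpermD //; [apply: contraNneq Su => -> | apply: contraNneq Sv => ->].
exists (tperm u v * a); last by rewrite imset_permM tS.
by rewrite Alt_even odd_permM odd_tperm uv odd_a.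
Qed.

Definition low_stab (n : nat) (G : {group 'S_n}) (k : nat) : {group 'S_n} :=
  'N_G([set i : 'I_n | i < k] | 'P)%G.

Lemma card_low (n k : nat) : k <= n -> #|[set i : 'I_n | i < k]| = k.
Proof. by move=> le_k; rewrite -sum1dep_card (big_ord_narrow le_k) sum1_card card_ord.
Qed.

Lemma low_stab_proper (n : nat) (G : {group 'S_n}) (k : nat) :
  2 < n -> 'Alt_('I_n) \subset G -> 0 < k < n -> low_stab G k \proper G.
Proof.
move=> n3 sAG /andP[k0 kn]; rewrite /low_stab properE subsetIl /=.
have n0 : 0 < n by apply: leq_trans n3.
pose u := Ordinal n0; pose v := Ordinal kn.
have uv : u != v by rewrite -val_eqE /= neq_ltn k0.
have [w wN] : exists w, w \in ~: [set u; v].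
  by apply/card_gt0P; rewrite cardsCs setCK card_ord cards2 uv; lia.
have U3 : uniq [:: u; v; w].
  by move: wN; rewrite /= !inE !negb_or !(eq_sym w) uv => /andP[-> ->].
apply/subsetPn; exists (cycle3 u v w); first by rewrite (subsetP sAG) ?Alt_cycle3.
rewrite inE negb_and; apply/orP; right; apply/negP=> /astabsP/(_ u).
by have [Eu _ _ _] := cycle3E U3; rewrite /= apermE Eu !inE /= k0 ltnn.
Qed.

Lemma mem_low_stab (n : nat) (G : {group 'S_n}) (x : 'S_n) (S : {set 'I_n}) :
  2 < n -> 'Alt_('I_n) \subset G -> x \in G -> x @: S = S ->
  exists2 g, g \in G & x \in low_stab G #|S| :^ g.
Proof.
move=> n3 sAG Gx xS.
have cS : #|S| = #|[set i : 'I_n | i < #|S|]|.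
  by rewrite card_low // -[leqRHS]card_ord max_card.
have [||a Aa aS] := @exists_Alt_imset _ S [set i : 'I_n | i < #|S|]; rewrite ?card_ord //.
have Ga := subsetP sAG _ Aa; exists a^-1; rewrite ?groupV // mem_conjgV.
rewrite /low_stab inE groupJ //=; apply/astabsP=> i.
rewrite -aS -(permKV a i) /= apermE permJ !(mem_imset _ _ (@perm_inj _ a)).
by rewrite -{1}xS (mem_imset _ _ (@perm_inj _ x)).
Qed.

Definition full_cycle (T : finType) (x : {perm T}) := forall z, porbit x z = setT.

Lemma exists_full_cycle (T : finType) : exists c : {perm T}, full_cycle c.
Proof.
have [c porb_c] := @exists_perm_fibers T _ (fun=> tt); exists c => z.
by rewrite porb_c; apply/setP=> y; rewrite !inE.
Qed.

(** The conjugating permutation sends x^i z0 to y^i z0; it is well defined because both sides depend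
    on i exactly modulo |T|. *)
Lemma full_cycle_conj (T : finType) (x y : {perm T}) :
  full_cycle x -> full_cycle y -> exists a, y = x ^ a.
Proof.
move=> fx fy; have [z0 _ | T0] := pickP T; last first.
  by exists 1; apply/permP=> z; have := T0 z.
have powx z : exists i, z == (x ^+ i) z0.
  have /porbitP[i ->] : z \in porbit x z0 by rewrite fx inE.
  by exists i.
have modX (s : {perm T}) i j : full_cycle s ->
    (((s ^+ i) z0 == (s ^+ j) z0) = (i == j %[mod #|T|])).
  move=> fs; have n0 : 0 < #|T| by apply/card_gt0P; exists z0.
  have cs : #|porbit s z0| = #|T| by rewrite fs cardsT.
  have sn : (s ^+ #|T|) z0 = z0 by rewrite permX -cs iter_porbit.
  have red k : (s ^+ k) z0 = nth z0 (traject s z0 #|T|) (k %% #|T|).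
    rewrite nth_traject ?ltn_pmod // {1}(divn_eq k #|T|) expgD permM mulnC expgM.
    by rewrite (permX_fix _ sn) permX.
  by rewrite !red nth_uniq ?size_traject ?ltn_pmod // -cs uniq_traject_porbit.
pose idx z := xchoose (powx z).
have idxP z : (x ^+ idx z) z0 = z by rewrite -(eqP (xchooseP (powx z))).
pose f z := (y ^+ idx z) z0.
have f_inj : injective f.
  by move=> u v /eqP; rewrite /f modX // -(modX x) // !idxP => /eqP.
exists (perm f_inj); apply/permP=> u.
have [z ->] : exists z, u = perm f_inj z by exists ((perm f_inj)^-1 u); rewrite permKV.
rewrite permJ !permE /f -permM -expgSr; apply/eqP.
by rewrite modX // -(modX x) // expgSr permM !idxP.
Qed.

Lemma porbit_invariant (T : finType) (x : {perm T}) (z : T) :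
  x @: porbit x z = porbit x z.
Proof.
apply/eqP; rewrite eqEcard (card_imset _ (@perm_inj _ x)) leqnn andbT.
apply/subsetP=> _ /imsetP[y zy ->].
have <- : porbit x y = porbit x z by apply/eqP; rewrite eq_porbit_mem.
exact: (mem_porbit x 1).
Qed.

Lemma invariantC (T : finType) (x : {perm T}) (S : {set T}) :
  x @: S = S -> x @: (~: S) = ~: S.
Proof. by move=> xS; rewrite -preim_permV preimsetC preim_permV xS. Qed.

Lemma full_cycle_or_half (T : finType) (x : {perm T}) :
  full_cycle x \/ exists2 S : {set T}, x @: S = S & 0 < #|S| <= #|T| %/ 2.
Proof.
have [/forallP fx | ] := boolP [forall z, porbit x z == setT].
  by left=> z; apply/eqP.
rewrite negb_forall => /existsP[z nz]; right.
have lt_n : #|porbit x z| < #|T|.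
  by rewrite -cardsT proper_card // properEneq nz subsetT.
have gt0 : 0 < #|porbit x z| by rewrite lt0n card_porbit_neq0.
have cC := cardsC (porbit x z).
have [le2 | lt2] := leqP #|porbit x z| (#|T| %/ 2).
  by exists (porbit x z); rewrite ?porbit_invariant ?gt0.
by exists (~: porbit x z); [rewrite invariantC ?porbit_invariant | lia].
Qed.

(** An even permutation of an odd number of points has an odd number of cycles, hence one or at
    least three, and the smallest of three has at most a third of the points. *)
Lemma odd_card_Alt_third (T : finType) (x : {perm T}) :
  odd #|T| -> x \in 'Alt_T ->
  full_cycle x \/ exists2 S : {set T}, x @: S = S & 0 < #|S| <= #|T| %/ 3.
Proof.
move=> oddT; rewrite Alt_even /odd_perm oddT /= negbK => odd_x.
have [/forallP fx | ] := boolP [forall z, porbit x z == setT].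
  by left=> z; apply/eqP.
rewrite negb_forall => /existsP[u nu]; right.
have disj y z : y \notin porbit x z -> [disjoint porbit x y & porbit x z].
  apply: contraR => /pred0Pn[t /= /andP[ty tz]].
  by move: ty tz; rewrite -!eq_porbit_mem => /eqP-> .
have [v vu] : exists v, v \notin porbit x u.
  apply/existsP; rewrite -negb_forall; apply: contra nu => /forallP all_u.
  by apply/eqP/setP=> z; rewrite all_u inE.
have [w /norP[wu wv]] : exists w, ~~ ((w \in porbit x u) || (w \in porbit x v)).
  apply/existsP; rewrite -negb_forall; apply: contraL odd_x => /forallP all_uv.
  have -> : porbits x = [set porbit x u; porbit x v].
    apply/setP=> A; rewrite !inE; apply/imsetP/orP=> [[z _ ->] | [] /eqP->].
    - by rewrite !eq_porbit_mem; apply/orP.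
    - by exists u.
    - by exists v.
  by rewrite cards2 eq_sym eq_porbit_mem vu.
have le_n : (#|porbit x u| + #|porbit x v| + #|porbit x w| <= #|T|)%N.
  have cardU (A B : {set T}) : [disjoint A & B] -> #|A :|: B| = (#|A| + #|B|)%N.
    by move=> dAB; rewrite cardsU disjoint_setI0 // cards0 subn0.
  have duv : [disjoint porbit x u & porbit x v] by rewrite disjoint_sym disj.
  have dw : [disjoint porbit x u :|: porbit x v & porbit x w].
    by rewrite disjoint_sym -setI_eq0 setIUr setU_eq0 !setI_eq0 !disj.
  by rewrite -(cardU _ _ duv) -(cardU _ _ dw) max_card.
have pos z : 0 < #|porbit x z| by rewrite lt0n card_porbit_neq0.
have [z lez] : exists z, #|porbit x z| <= #|T| %/ 3.
  have [lu | lu] := leqP #|porbit x u| (#|T| %/ 3); first by exists u.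
  have [lv | lv] := leqP #|porbit x v| (#|T| %/ 3); first by exists v.
  by exists w; lia.
by exists (porbit x z); rewrite ?porbit_invariant ?pos.
Qed.

Lemma cycle_proper (gT : finGroupType) (G : {group gT}) (x : gT) :
  ~~ cyclic G -> x \in G -> <[x]>%G \proper G.
Proof.
move=> ncG Gx; rewrite properE cycle_subG Gx /=; apply: contra ncG => sGx.
by apply/cyclicP; exists x; apply/eqP; rewrite eqEsubset sGx cycle_subG.
Qed.

Lemma gamma_le_add (n : nat) (G : {group 'S_n}) (s : seq {group 'S_n}) (k : nat) :
  2 < n -> 'Alt_('I_n) \subset G -> ~~ cyclic G -> k < n ->
  (forall H, H \in s -> H \proper G) ->
  (forall x, x \in G ->
     (exists2 H, H \in s & exists2 g, g \in G & x \in H :^ g)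
     \/ exists2 S : {set 'I_n}, x @: S = S & 0 < #|S| <= k) ->
  gamma G <= size s + k.
Proof.
move=> n3 sAG ncG lt_kn prop_s cov_s.
pose t := [seq low_stab G i | i <- iota 1 k].
have -> : (size s + k = size (s ++ t))%N by rewrite size_cat size_map size_iota.
apply: gamma_le_size => // [H | x Gx].
  rewrite mem_cat => /orP[/prop_s // | /mapP[i]].
  rewrite mem_iota => /andP[i0 ik] ->; apply: low_stab_proper => //.
  by rewrite i0; apply: leq_trans lt_kn; rewrite addnC addn1 in ik.
have [[H sH xH] | [S xS /andP[S0 Sk]]] := cov_s x Gx.
  by exists H; rewrite // mem_cat sH.
exists (low_stab G #|S|); last exact: mem_low_stab.
by rewrite mem_cat; apply/orP; right; apply: map_f; rewrite mem_iota S0 add1n ltnS.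
Qed.

Lemma full_cycle_odd (n : nat) (x : 'S_n) : 0 < n -> full_cycle x -> odd_perm x = ~~ odd n.
Proof.
move=> n0 fx; rewrite /odd_perm card_ord -addbT; congr (_ (+) _).
have -> : porbits x = [set setT]; last by rewrite cards1.
apply/setP=> A; rewrite !inE; apply/imsetP/eqP=> [[z _ ->] | ->]; first exact: fx.
by exists (Ordinal n0); rewrite ?fx.
Qed.

Lemma gamma_Sym (n : nat) : 2 < n -> gamma ('Sym_('I_n))%G <= 1 + n %/ 2.
Proof.
move=> n3; have ncG : ~~ cyclic 'Sym_('I_n) by apply: Sym_not_cyclic; rewrite card_ord.
have [c fc] := exists_full_cycle 'I_n.
apply: (@gamma_le_add _ _ [:: <[c]>%G]) => //.
- exact: Alt_subset.
- by lia.
- by move=> H; rewrite inE => /eqP->; apply: cycle_proper; rewrite ?inE.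
move=> x _; have [fx | [S xS Sn]] := full_cycle_or_half x.
  left; exists <[c]>%G; rewrite ?inE //; have [a ->] := full_cycle_conj fc fx.
  by exists a; rewrite ?inE // memJ_conjg cycle_id.
by right; exists S => //; move: Sn; rewrite card_ord.
Qed.

(** The general bound gives 3 > 8/3 here. A permutation of four points without fixed point has order
    dividing 4, so a Sylow 2-subgroup and a point stabiliser suffice. *)
Lemma gamma_Sym4 : gamma ('Sym_('I_4))%G <= 2.
Proof.
have ncG : ~~ cyclic 'Sym_('I_4) by apply: Sym_not_cyclic; rewrite card_ord.
have [P sylP] := Sylow_exists 2 ('Sym_('I_4))%G.
apply: (@gamma_le_add _ _ [:: P] 1) => //.
- exact: Alt_subset.
- move=> H; rewrite inE => /eqP->; rewrite properEcard (pHall_sub sylP) /=.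
  by rewrite (card_Hall sylP) (@alt.card_Sym _) card_ord p_part.
move=> x Gx; have [/existsP[z /eqP xz] | nofix] := boolP [exists z, x z == z].
  by right; exists [set z]; rewrite ?cards1 // imset_set1 xz.
left; exists P; rewrite ?inE //.
have x4 : x ^+ 4 = 1.
  apply/permP=> z; rewrite perm1.
  have invx := porbit_invariant x z; have cC := cardsC (porbit x z).
  have : #|porbit x z| \in [:: 2; 4].
    have no1 (S : {set 'I_4}) : x @: S = S -> #|S| != 1%N.
      move=> xS; apply: contra nofix => /cards1P[u Su]; apply/existsP; exists u.
      by move: xS; rewrite Su imset_set1 => /set1_inj->.
    have := no1 _ invx; have := no1 _ (invariantC invx).
    have : #|porbit x z| != 0 by apply: card_porbit_neq0.
    by move: cC; rewrite card_ord !inE; move: #|porbit x z| #|~: _| => a b; clear; lia.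
  have := iter_porbit x z; rewrite -permX; case: #|_| => [|[|[|[|[|?]]]]] //= fixz _.
  by rewrite -[4]/(2 * 2)%N expgM permX_fix.
have px : 2.-group <[x]>.
  rewrite /pgroup -[#|_|]/#[x]; apply: (@pnat_dvd _ (2 ^ 2)%N); last by rewrite pnatX.
  by rewrite order_dvdn x4.
have sxS : <[x]> \subset 'Sym_('I_4) by rewrite cycle_subG.
have [g Gg sxP] := Sylow_subJ sylP sxS px.
by exists g; rewrite // -cycle_subG.
Qed.

Lemma gamma_Alt_even (n : nat) : 3 < n -> ~~ odd n -> gamma ('Alt_('I_n))%G <= n %/ 2.
Proof.
move=> n4 even_n.
have ncG : ~~ cyclic 'Alt_('I_n) by apply: Alt_not_cyclic; rewrite ?card_ord.
have lt_n : n %/ 2 < n by apply: ltn_Pdiv => //; apply: leq_trans n4.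
apply: (@gamma_le_add _ _ [::]) => //; first exact: ltnW.
move=> x; rewrite Alt_even => even_x; right.
have [fx | [S xS Sn]] := full_cycle_or_half x.
  by rewrite (full_cycle_odd _ fx) ?even_n in even_x; lia.
by exists S => //; move: Sn; rewrite card_ord.
Qed.

Lemma gamma_Alt_odd (n : nat) : 3 < n -> odd n -> gamma ('Alt_('I_n))%G <= 2 + n %/ 3.
Proof.
move=> n4 odd_n.
have ncG : ~~ cyclic 'Alt_('I_n) by apply: Alt_not_cyclic; rewrite ?card_ord.
have [c fc] := exists_full_cycle 'I_n.
have n1 : 1 < n by lia.
(* The n-cycles are one class of Sym(n) but may split in Alt(n); conjugation by the odd [t] reaches
   the other part. *)
pose t : 'S_n := tperm (Ordinal (ltnW n1)) (Ordinal n1).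
have Ac : c \in 'Alt_('I_n) by rewrite Alt_even (full_cycle_odd _ fc) ?odd_n; lia.
have At : c ^ t \in 'Alt_('I_n) by rewrite Alt_even odd_permJ -Alt_even.
apply: (@gamma_le_add _ _ [:: <[c]>%G; <[c ^ t]>%G]) => //; first exact: ltnW.
- by apply: ltn_Pdiv => //; apply: leq_trans n4.
- by move=> H; rewrite !inE => /orP[] /eqP->; apply: cycle_proper.
move=> x Ax; have [||fx | [S xS Sn]] := @odd_card_Alt_third _ x; rewrite ?card_ord //.
  left; have [a ->] := full_cycle_conj fc fx.
  have [odd_a | even_a] := boolP (odd_perm a); last first.
    by exists <[c]>%G; rewrite ?inE ?eqxx //; exists a; rewrite ?Alt_even // memJ_conjg cycle_id.
  exists <[c ^ t]>%G; first by rewrite !inE eqxx orbT.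
  exists (t^-1 * a); first by rewrite Alt_even odd_permM odd_permV odd_tperm odd_a.
  by rewrite -{1}(mulKVg t a) conjgM memJ_conjg cycle_id.
by right; exists S => //; move: Sn; rewrite card_ord.
Qed.

Lemma gamma_bound (n : nat) (G : {group 'S_n}) :
  G = ('Sym_('I_n))%G /\ 2 < n \/ G = ('Alt_('I_n))%G /\ 3 < n ->
  ~~ cyclic G /\ (3 * gamma G <= 2 * n)%N.
Proof.
case=> -[-> n_big].
  split; first by apply: Sym_not_cyclic; rewrite card_ord.
  have [n4 | n4] := eqVneq n 4; last by move: (gamma_Sym n_big) n4 (n_big); move: (gamma _) => g; lia.
  by rewrite n4; move: gamma_Sym4; move: (gamma _) => g; lia.
split; first by apply: Alt_not_cyclic; rewrite ?card_ord.
have [odd_n | even_n] := boolP (odd n).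
  by move: (gamma_Alt_odd n_big odd_n) (odd_n) (n_big); move: (gamma _) => g; lia.
by move: (gamma_Alt_even n_big even_n) (n_big); move: (gamma _) => g; lia.
Qed.

Local Close Scope group_scope.
Import Order.TTheory GRing.Theory Num.Theory.
Local Open Scope ring_scope.

Theorem theorem1p1 (R : realType) :
  exists2 c : R, 0 < c &
  forall (n : nat) (G : {group 'S_n}),
    [/\ G = ('Sym_('I_n))%G, (3 <= n)%N & n <> 6%N] \/
      (G = ('Alt_('I_n))%G /\ (4 <= n)%N) ->
    [/\ c * n%:R <= (kappa G)%:R,
        (kappa G <= gamma G)%N
      & (gamma G)%:R <= 2 / 3 * n%:R :> R].
Proof.
have [C defC] : exists C, C = (100 * 100)%N by exists (100 * 100)%N.
have C0 : (0 < C)%N by rewrite defC.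
exists C%:R^-1 => [|n G GSA]; first by rewrite invr_gt0 ltr0n.
have [ncG le_gamma] : ~~ cyclic G /\ (3 * gamma G <= 2 * n)%N.
  by apply: gamma_bound; case: GSA => [[-> n3 _] | [-> n4]]; [left | right].
split.
- rewrite mulrC ler_pdivrMr ?ltr0n // -natrM ler_nat mulnC defC.
  (* Below the threshold 7220 the bound kappa >= 1 suffices for the constant 1/10000. *)
  have [n_small | n_big] := ltnP n (20 * 361); last first.
    by apply: kappa_lower_bound n_big; case: GSA => [[-> _ _] | [-> _]]; [left | right].
  apply: (@leq_trans (100 * 100 * 1)); last by rewrite leq_mul2l kappa_gt0 orbT.
  by move: n_small; clear; lia.
- exact: kappa_le_gamma.
- by rewrite mulrAC ler_pdivlMr ?ltr0n // -!natrM ler_nat mulnC.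
Qed.
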